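(* For all integers $1\le s\le t$, $$\delta_{\mathrm{hom}}(K_{1,s,t})\ \ge\ \max\left\{\frac13,\ \frac{s}{1+s+t}\right\}.$$ Moreover, if $(t-s+1)^2\le s$ and $3s\ge 2+2t$, then $$\delta_{\mathrm{hom}}(K_{1,s,t})=\frac{s}{1+s+t}.$$
   Context: All graphs are finite and simple. A graph is $H$-free if it contains no (not necessarily induced) subgraph isomorphic to $H$. $K_{1,s,t}$ is the complete tripartite graph with parts of sizes $1,s,t$. $\delta(G)$ denotes minimum degree. The homomorphism threshold of a graph $H$, denoted $\delta_{\mathrm{hom}}(H)$, is the infimum of all $\gamma\ge 0$ for which there exists a (finite) $H$-free graph $F=F(\gamma,H)$ such that every $H$-free graph $G$ with $\delta(G)\ge\gamma|V(G)|$ admits a graph homomorphism to $F$. *)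

(* Defs.v *)
From HB Require Import structures.
From mathcomp Require Import all_boot all_order all_algebra.
From mathcomp Require Import classical_sets reals.

Set Implicit Arguments.
Unset Strict Implicit.
Unset Printing Implicit Defensive.

Import Order.TTheory GRing.Theory Num.Theory.

Record sgraph := SGraph {
  vertex :> finType;
  adj : rel vertex;
  adj_sym : symmetric adj;
  adj_irr : irreflexive adj
}.

Definition is_hom (G F : sgraph) (f : G -> F) : Prop :=
  forall x y : G, adj x y -> adj (f x) (f y).

Definition homomorphic (G F : sgraph) : Prop :=
  exists f : G -> F, is_hom f.

(* Copies of H in G need not be induced. *)
Definition contains (G H : sgraph) : Prop :=
  exists2 f : H -> G, injective f & is_hom f.

Definition free (H G : sgraph) : Prop := ~ contains G H.

Definition degree (G : sgraph) (v : G) : nat := #|[set w | adj v w]|.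

(* Every degree is less than #|G|, so the default value #|G| of the minimum
   is never attained when G has a vertex; the graph without vertices gets
   minimum degree 0. *)
Definition min_degree (G : sgraph) : nat :=
  \big[minn/#|G|]_(v : G) degree v.

Section CompleteTripartite.
Variables a b c : nat.

Definition tri_part (x : 'I_a + 'I_b + 'I_c) : nat :=
  match x with
  | inl (inl _) => 0
  | inl (inr _) => 1
  | inr _ => 2
  end.

Definition tri_adj : rel ('I_a + 'I_b + 'I_c)%type :=
  fun x y => tri_part x != tri_part y.

Lemma tri_adj_sym : symmetric tri_adj.
Proof. by move=> x y; rewrite /tri_adj eq_sym. Qed.

Lemma tri_adj_irr : irreflexive tri_adj.
Proof. by move=> x; rewrite /tri_adj eqxx. Qed.

Definition complete_tripartite : sgraph := SGraph tri_adj_sym tri_adj_irr.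

End CompleteTripartite.

Local Open Scope classical_set_scope.
Local Open Scope ring_scope.

Definition hom_bounding (R : realType) (H : sgraph) : set R :=
  [set gamma : R | 0 <= gamma /\
    exists2 F : sgraph, free H F &
      forall G : sgraph, free H G ->
        gamma * #|G|%:R <= (min_degree G)%:R -> homomorphic G F].

Arguments hom_bounding R H : clear implicits.

(* If H has a vertex, this set contains 1 (witnessed by the graph F without
   vertices) and is bounded below by 0, so that inf is its genuine infimum. *)
Definition hom_threshold (R : realType) (H : sgraph) : R :=
  inf (hom_bounding R H).
Arguments hom_threshold R H : clear implicits.

(* Main.v *)
Require Import Defs.
From HB Require Import structures.
From mathcomp Require Import all_boot all_order all_algebra.
From mathcomp Require Import classical_sets reals.
From mathcomp Require Import boolp zify ring lra.
From mathcomp Require Import fintype finset.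

Set Implicit Arguments.
Unset Strict Implicit.
Unset Printing Implicit Defensive.

Import Order.TTheory GRing.Theory Num.Theory.

(** Lower bounds. A graph F that serves for gamma is tested on two families.
    Hajnal's graphs attach to the Kneser graph of the large subsets of [n] a
    complete bipartite graph that carries almost all vertices; they are
    triangle-free of minimum degree close to a third of the order. A colour class
    of the Kneser graph generates an intersecting family, and by Harris' inequality
    k intersecting families miss at least 2^(n-k) of the subsets of [n] (Kleitman),
    more than the few that are too small to be vertices; hence the chromatic
    number is unbounded. The second family consists of many disjoint copies of
    K_{1+t}, of disjoint copies of K_s each joined to s cyclically consecutive
    vertices of every K_{1+t}, and of an independent set joined to all K_s. When
    1 + t <= 2s, a homomorphism to a small graph identifies two copies of K_{1+t},
    and the s-sets of a suitable K_s in these two copies cover K_{1+t}: the image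
    contains K_{1+s+t}.

    Upper bound. Let the minimum degree exceed s n / (1 + s + t) >= 2n/5. Having
    linearly many common neighbours is then an equivalence relation with at most
    two classes X and Y, and K_{1,s,t}-freeness bounds the degrees inside X and
    inside Y by a constant. Almost all vertices of Y see at most s-1 neighbours
    of x in X whenever they see x; double counting gives maximum degrees s-1+a and
    s-1+b in X and Y with a + b <= t-s+1. The greedy colouring uses s+a and s+b
    colours, and if a + b = t-s+1 Brooks' theorem saves one colour, because X and Y
    cannot both contain cliques of order s+a and s+b. So large graphs are
    (s+t)-colourable, and F is the disjoint union of K_{s+t} and all small
    K_{1,s,t}-free graphs. *)

(** * Colouring and Brooks' theorem *)

Section Coloring.
Variables (T : finType) (e : rel T).
Hypotheses (e_sym : symmetric e) (e_irr : irreflexive e).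

Definition nbrs (W : {set T}) (v : T) : {set T} := [set w in W | e v w].

Definition coloring (k : nat) (W : {set T}) (f : T -> nat) : Prop :=
  {in W, forall x, f x < k} /\ {in W &, forall x y, e x y -> f x != f y}.

Definition colorable (k : nat) (W : {set T}) : Prop := exists f, coloring k W f.

Lemma coloring_sub k (W W' : {set T}) f :
  W' \subset W -> coloring k W f -> coloring k W' f.
Proof.
move=> /subsetP sub [lt_f ne_f]; split=> [x /sub|x y /sub xW /sub]; first exact: lt_f.
exact: ne_f.
Qed.

(** Some colour below [k] is missing on the neighbours of [v]. Distinct colours are counted rather
    than neighbours, so that a repeated colour can be exploited. *)
Lemma coloring_extend k (W : {set T}) v f :
  v \notin W -> coloring k W f -> size (undup [seq f w | w <- enum (nbrs W v)]) < k ->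
  exists2 g, coloring k (v |: W) g & {in W, f =1 g}.
Proof.
move=> vW [lt_f ne_f]; set cs := undup _ => lt_cs.
have [c c_lt c_free] : exists2 c, c < k & c \notin cs.
  have /allPn[c] : ~~ all (mem cs) (iota 0 k).
    apply/negP=> /allP sub.
    have := uniq_leq_size (iota_uniq 0 k) sub; rewrite size_iota; lia.
  by rewrite mem_iota => ck cN; exists c.
have cN w : w \in W -> e v w -> f w != c.
  move=> wW vw; apply: contraNneq c_free => <-.
  by rewrite mem_undup map_f // mem_enum inE wW.
have nv w : w \in W -> (w == v) = false by move=> wW; apply: contraNF vW => /eqP <-.
exists (fun w => if w == v then c else f w); last by move=> w /nv ->.
split=> [x|x y]; rewrite !in_setU1.
  by case: eqP => //= _ xW; exact: lt_f.
case: (eqVneq x v) => [->|_] /=; case: (eqVneq y v) => [->|_] //=.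
- by rewrite e_irr.
- by move=> _ yW vy; rewrite eq_sym cN.
- by move=> xW _; rewrite e_sym => vx; rewrite cN.
- exact: ne_f.
Qed.

Lemma coloring_extend_deg k (W : {set T}) v f :
  v \notin W -> coloring k W f -> #|nbrs W v| < k ->
  exists2 g, coloring k (v |: W) g & {in W, f =1 g}.
Proof.
move=> vW fP lt_k; apply: coloring_extend => //.
by apply: leq_ltn_trans lt_k; rewrite (leq_trans (size_undup _)) // size_map cardE.
Qed.

(** Two neighbours of equal colour leave at most k - 1 colours on the neighbourhood, so [v] may have
    as many as [k] neighbours. *)
Lemma coloring_extend_eq k (W : {set T}) v u w f :
  v \notin W -> coloring k W f -> #|nbrs W v| <= k ->
  u \in nbrs W v -> w \in nbrs W v -> u != w -> f u = f w ->
  exists2 g, coloring k (v |: W) g & {in W, f =1 g}.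
Proof.
move=> vW fP le_k uN wN uw fuw; apply: coloring_extend => //.
have us : u \in enum (nbrs W v) by rewrite mem_enum.
set s := enum _ in us *.
have sub : {subset undup [seq f x | x <- s] <= [seq f x | x <- rem u s]}.
  move=> c; rewrite mem_undup => /mapP[x xs ->].
  case: (eqVneq x u) => [->|xu].
    by rewrite fuw map_f // mem_rem_uniq ?enum_uniq // inE eq_sym uw mem_enum.
  by rewrite map_f // mem_rem_uniq ?enum_uniq // inE xu.
apply: leq_ltn_trans (uniq_leq_size (undup_uniq _) sub) _.
rewrite size_map size_rem //.
have: 0 < size s by rewrite /s -cardE; apply/card_gt0P; exists u.
by rewrite -cardE in le_k *; lia.
Qed.

Lemma nbrs_lt (W A : {set T}) v w k :
  #|nbrs W v| <= k -> A \subset W -> w \in W -> e v w -> w \notin A ->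
  #|nbrs A v| < k.
Proof.
move=> le_k /subsetP AW wW vw wA; apply: leq_trans le_k; apply: proper_card.
apply/properP; split; first by apply/subsetP=> z; rewrite !inE => /andP[/AW -> ->].
by exists w; rewrite !inE ?wW // (negPf wA).
Qed.

(* Every vertex of the path but the last still has an uncoloured neighbour,
   its successor, when its turn comes. *)
Lemma path_coloring k (W A : {set T}) p w f :
  {in W, forall v, #|nbrs W v| <= k} -> A \subset W -> coloring k A f ->
  sorted e (rcons p w) -> uniq (rcons p w) ->
  {subset rcons p w <= W} -> {in rcons p w, forall z, z \notin A} ->
  exists2 g, coloring k (A :|: [set z in p]) g & {in A, f =1 g}.
Proof.
move=> deg; elim: p A f => [|v p IH] A f AW fP so un sub nA.
  by exists f => //; apply: coloring_sub fP; apply/subsetP=> z; rewrite !inE orbF.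
have [z /= vz zin] : exists2 z, e v z & z \in rcons p w.
  case: p so {IH un sub nA} => [|z p] /=; first by rewrite andbT => vw; exists w; rewrite ?inE.
  by case/andP=> vz _; exists z; rewrite ?inE ?eqxx.
have vW : v \in W by apply: sub; rewrite inE eqxx.
have vA : v \notin A by apply: nA; rewrite inE eqxx.
have zW : z \in W by apply: sub; rewrite inE zin orbT.
have zA : z \notin A by apply: nA; rewrite inE zin orbT.
have [g gP fg] := coloring_extend_deg vA fP (nbrs_lt (deg _ vW) AW zW vz zA).
move: un => /= /andP[vp un].
case: (IH (v |: A) g) => //.
- by rewrite subUset sub1set vW.
- exact: path_sorted so.
- by move=> y yp; apply: sub; rewrite inE yp orbT.
- move=> y yp; rewrite !inE negb_or nA ?inE ?yp ?orbT // andbT.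
  by apply: contraNneq vp => <-.
move=> h hP gh; exists h; last by move=> y yA; rewrite fg // gh // !inE yA orbT.
apply: coloring_sub hP; apply/subsetP=> y; rewrite !inE.
by case/or3P=> -> //; rewrite ?orbT.
Qed.

(** Greedy extension at the far end stops only when the last vertex has all its neighbours in [W] on
    the path. *)
Lemma maximal_path (W : {set T}) x p :
  {subset x :: p <= W} -> path e x p -> uniq (x :: p) ->
  exists q, [/\ {subset x :: p ++ q <= W}, path e x (p ++ q), uniq (x :: p ++ q)
     & {in W, forall z, e (last x (p ++ q)) z -> z \in x :: p ++ q}].
Proof.
have [n] := ubnP (#|W| - size p); elim: n p => // n IH p lt_n sub pa un.
case: (pickP [pred z in W | e (last x p) z && (z \notin x :: p)]) => [z|no] /=.
  case/and3P=> zW pz zp.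
  case: (IH (rcons p z)).
  - have : size (z :: x :: p) <= #|W|.
      rewrite cardE; apply: uniq_leq_size; first by rewrite /= zp.
      by move=> y; rewrite inE mem_enum => /predU1P[->|/sub].
    rewrite size_rcons => /= lt_sz; move: lt_n lt_sz; clear;
      set c := #|W|; move: (size p) c => a c; lia.
  - by move=> y; rewrite -rcons_cons mem_rcons inE => /predU1P[->|/sub].
  - by rewrite rcons_path pa.
  - by rewrite -rcons_cons rcons_uniq zp.
  by move=> q; rewrite cat_rcons; exists (z :: q).
exists [::]; rewrite cats0; split=> // z zW pz.
by apply: contraFT (no z) => zp; rewrite /= zW pz.
Qed.

Lemma last_switch (Q : pred T) (x : T) p :
  has Q (x :: p) -> ~~ Q (last x p) ->
  exists l1 a b l2, [/\ x :: p = l1 ++ a :: b :: l2, Q a & ~~ Q b].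
Proof.
elim: p x => [|y p IH] x /=; first by rewrite orbF => ->.
case: (boolP (has Q (y :: p))) => [hy _ nl|nh].
  by have [l1 [a [b [l2 [-> Qa Qb]]]]] := IH y hy nl; exists (x :: l1), a, b, l2.
move: (nh); rewrite /= => /negPf ->; rewrite orbF => Qx _.
by exists [::], x, y, p; split=> //; apply: contra nh => /= ->.
Qed.

Lemma union_coloring k (A B : {set T}) f g :
  coloring k A f -> coloring k B g ->
  {in A & B, forall x y, ~~ e x y} -> colorable k (A :|: B).
Proof.
move=> [lt_f ne_f] [lt_g ne_g] AB.
exists (fun x => if x \in A then f x else g x); split=> [x|x y]; rewrite !inE.
  by case: ifP => [xA _|_ /= xB]; [exact: lt_f|exact: lt_g].
case: ifP => xA; case: ifP => yA /= xB yB.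
- exact: ne_f.
- by rewrite (negPf (AB _ _ xA yB)).
- by rewrite e_sym (negPf (AB _ _ yA xB)).
- exact: ne_g.
Qed.

Lemma colorableW k l (W : {set T}) : k <= l -> colorable k W -> colorable l W.
Proof. by move=> kl [f [f1 f2]]; exists f; split=> // x xW; apply: leq_trans (f1 x xW) kl. Qed.

Lemma colorable_setC k l (W : {set T}) :
  colorable k W -> colorable l (~: W) -> colorable (k + l) [set: T].
Proof.
move=> [f [f1 f2]] [g [g1 g2]]; exists (fun x => if x \in W then f x else k + g x).
split=> [x _|x y _ _ xy].
  case: ifP => xW; first by rewrite (leq_trans (f1 x xW)) ?leq_addr.
  by rewrite ltn_add2l g1 // inE xW.
case: ifP => xW; case: ifP => yW; first exact: f2.
- by rewrite neq_ltn (leq_trans (f1 x xW)) ?leq_addr.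
- by rewrite neq_ltn (leq_trans (f1 y yW)) ?leq_addr ?orbT.
- by rewrite eqn_add2l g2 // inE ?xW ?yW.
Qed.

Lemma greedy_coloring k (W : {set T}) :
  {in W, forall v, #|nbrs W v| < k} -> colorable k W.
Proof.
have [n] := ubnP #|W|; elim: n W => // n IH W lt_n deg.
have [->|[v vW]] := set_0Vmem W.
  by exists (fun _ => 0); split=> [x|x y]; rewrite inE.
have lt_v (w : T) : #|nbrs (W :\ v) w| <= #|nbrs W w|.
  by apply/subset_leq_card/subsetP=> z; rewrite !inE => /andP[/andP[_ ->] ->].
have [f fP] : colorable k (W :\ v).
  apply: IH => [|w]; first by move: lt_n; rewrite (cardsD1 v W) vW; lia.
  by rewrite in_setD1 => /andP[_ /deg]; apply: leq_ltn_trans.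
have [||g gP _] := @coloring_extend_deg k (W :\ v) v f _ fP.
- by rewrite !inE eqxx.
- by apply: leq_ltn_trans (deg v vW).
by exists g; rewrite setD1K in gP.
Qed.

(* Zajac's argument: extend a path x, v, y with x, y non-adjacent to a maximal
   one and colour along it, or along the cycle that closes it up, leaving for
   the end a vertex with two neighbours of the same colour. *)
Lemma Brooks k (W : {set T}) :
  2 < k -> {in W, forall v, #|nbrs W v| <= k} ->
  (forall C : {set T}, C \subset W -> {in C &, forall x y, x != y -> e x y} -> #|C| <= k) ->
  colorable k W.
Proof.
move=> k3; have [n] := ubnP #|W|; elim: n W => // n IH W lt_n deg cl.
have IHsub (W' : {set T}) : W' \proper W -> colorable k W'.
  move=> /[dup] /properP[/subsetP sub _] /proper_card lt; apply: IH; first by lia.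
    move=> v /sub/deg; apply: leq_trans; apply/subset_leq_card/subsetP=> z.
    by rewrite !inE => /andP[/sub -> ->].
  by move=> C /subsetP CW'; apply: cl; apply/subsetP=> z /CW' /sub.
(* A vertex of degree below [k] can be coloured last; otherwise the graph on [W] is k-regular. *)
case: (pickP [pred v in W | #|nbrs W v| < k]) => [v /= /andP[vW dv]|reg].
  have [f fP] : colorable k (W :\ v) by apply: IHsub; rewrite properD1.
  have [||g gP _] := @coloring_extend_deg k (W :\ v) v f _ fP.
  - by rewrite !inE eqxx.
  - apply: leq_ltn_trans dv.
    by apply/subset_leq_card/subsetP=> z; rewrite !inE => /andP[/andP[_ ->] ->].
  by exists g; rewrite setD1K in gP.
have {}reg v : v \in W -> #|nbrs W v| = k.
  by move=> vW; apply/eqP; rewrite eqn_leq deg // leqNgt; have /= := reg v; rewrite vW /= => ->.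
have [->|[v vW]] := set_0Vmem W.
  by exists (fun _ => 0); split=> [x|x y]; rewrite inE.
(* Otherwise [v] and its [k] neighbours would form a clique of order k + 1. *)
have [x [y [xN yN xy nxy]]] : exists x y, [/\ x \in nbrs W v, y \in nbrs W v, x != y & ~~ e x y].
  case: (pickP [pred q : T * T |
    [&& q.1 \in nbrs W v, q.2 \in nbrs W v, q.1 != q.2 & ~~ e q.1 q.2]]).
    by case=> x y /= /and4P[]; exists x, y.
  move=> no; suff : #|v |: nbrs W v| <= k by rewrite cardsU1 reg // !inE vW e_irr /=; lia.
  apply: cl => [|a b].
    by apply/subsetP=> z; rewrite !inE => /predU1P[->|/andP[]].
  rewrite !in_setU1 => /predU1P[->|aN] /predU1P[->|bN] ab.
  - by rewrite eqxx in ab.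
  - by move: bN; rewrite inE => /andP[].
  - by rewrite e_sym; move: aN; rewrite inE => /andP[].
  - by have := no (a, b); rewrite /= aN bN ab /= => /negbFE.
have /andP[xW vx] : (x \in W) && e v x by rewrite inE in xN.
have /andP[yW vy] : (y \in W) && e v y by rewrite inE in yN.
have vnx : v != x by apply: contraTneq vx => ->; rewrite e_irr.
have vny : v != y by apply: contraTneq vy => ->; rewrite e_irr.
have [||| p [sub pa un mx]] := @maximal_path W x [:: v; y].
- by move=> z; rewrite !inE => /or3P[] /eqP ->.
- by rewrite /= e_sym vx vy.
- by rewrite /= !inE negb_or eq_sym vnx xy vny.
rewrite /= in sub pa un mx.
(* First case: the path covers [W]. A third neighbour [w] of [v] splits [p]: with [x] and [y] in one
   colour, [p1] is coloured forwards, then [p2] and [w] backwards towards [v], and [v] comes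
   last. *)
case: (boolP (W \subset [set z in [:: x, v, y & p]])) => [/subsetP full|nfull].
  have [w [wN wx wy]] : exists w, [/\ w \in nbrs W v, w != x & w != y].
    have : ~~ (nbrs W v \subset [set x; y]).
      by apply: contraL k3 => /subset_leq_card; rewrite reg // cards2 xy -leqNgt.
    by case/subsetPn=> w wN; rewrite !inE negb_or => /andP[wx wy]; exists w.
  have /andP[wW vw] : (w \in W) && e v w by rewrite inE in wN.
  have wp : w \in p.
    have := full w wW; rewrite !inE (negPf wx) (negPf wy) /=.
    by case: eqP => [wv|//]; rewrite wv e_irr in vw.
  case/splitPr: wp => p1 p2 in sub pa un mx full *.
  have pW z : z \in p1 ++ w :: p2 -> z \in W.
    by move=> zp; apply: sub; rewrite !inE zp !orbT.
  case/and3P: pa => _ _; rewrite cat_path /= => /and3P[pa1 e1w pa2].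
  case/and4P: un; rewrite !inE !negb_or => /and3P[_ _ xp] /andP[_ vp] yp un.
  have A0 : coloring k [set x; y] (fun _ => 0).
    split=> [z _|a b]; first exact: ltn_trans k3.
    by rewrite !inE => /orP[] /eqP-> /orP[] /eqP->;
      rewrite ?e_irr ?(negPf nxy) // e_sym (negPf nxy).
  have sub0 : [set x; y] \subset W by rewrite subUset !sub1set xW yW.
  have un1 : uniq (rcons p1 w) by move: un; rewrite -cat_rcons cat_uniq => /andP[].
  have s1 : {subset rcons p1 w <= p1 ++ w :: p2}.
    by move=> z; rewrite -cat_rcons mem_cat => ->.
  have [|||f1 f1P f01] := path_coloring deg sub0 A0 _ un1.
  - by apply: (@path_sorted _ _ y); rewrite rcons_path pa1.
  - by move=> z /s1 /pW.
  - move=> z /s1 zp; rewrite !inE negb_or.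
    by rewrite (contraNneq _ xp) ?(contraNneq _ yp) // => <-.
  set A1 := _ :|: _ in f1P.
  have sub1 : A1 \subset W.
    by rewrite subUset sub0; apply/subsetP=> z; rewrite inE => zp; apply: pW; rewrite mem_cat zp.
  have un2 : uniq (rcons (rev (w :: p2)) v).
    rewrite -rev_cons rev_uniq cons_uniq; move: un vp; rewrite cat_uniq mem_cat.
    by case/and3P=> _ _ ->; rewrite negb_or andbT => /andP[].
  have s2 z : z \in rcons (rev (w :: p2)) v -> z = v \/ z \in w :: p2.
    by rewrite mem_rcons inE mem_rev => /predU1P.
  have [|||f2 f2P f12] := path_coloring deg sub1 f1P _ un2.
  - rewrite -rev_cons rev_sorted /= e_sym vw /=.
    by rewrite (eq_path (e' := e)).
  - by move=> z /s2[->|zp] //; apply: pW; rewrite mem_cat zp orbT.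
  - move=> z /s2[->|zp]; rewrite !inE !negb_or ?vnx ?vny /=.
      by move: vp; rewrite mem_cat negb_or => /andP[].
    have zp' : z \in p1 ++ w :: p2 by rewrite mem_cat zp orbT.
    rewrite (contraNneq _ xp) ?(contraNneq _ yp) //= => [|<- //|<- //].
    move: un; rewrite cat_uniq => /and3P[_ /hasPn un _].
    exact: un.
  set A2 := _ :|: _ in f2P.
  have in01 z : z \in [set x; y] -> z \in A1 by move=> zA; apply/setUP; left.
  have in12 z : z \in A1 -> z \in A2 by move=> zA; apply/setUP; left.
  have x0 : x \in [set x; y] by rewrite !inE eqxx.
  have y0 : y \in [set x; y] by rewrite !inE eqxx orbT.
  have [|||||||f3 f3P _] := @coloring_extend_eq k A2 v x y f2.
  - move: vp; rewrite mem_cat !inE !negb_or vnx vny mem_rev inE negb_or => /andP[-> /andP[-> ->]].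
    by [].
  - by [].
  - apply: leq_trans (deg v vW); apply/subset_leq_card/subsetP=> z; rewrite !inE.
    case/andP=> zA ->; rewrite andbT; case/orP: zA => [zA1|].
      by apply: (subsetP sub1); rewrite !inE.
    by rewrite mem_rev => zp; apply: pW; rewrite mem_cat zp orbT.
  - by rewrite inE vx andbT in12 ?in01.
  - by rewrite inE vy andbT in12 ?in01.
  - by [].
  - by rewrite -!f12 ?in01 // -!f01.
  exists f3; apply: coloring_sub f3P; apply/subsetP=> z /full; rewrite !inE mem_cat mem_rev.
  by rewrite inE => /or4P[->|->|->|/or3P[->|->|->]]; rewrite ?orbT.
(* Second case: the path misses a vertex of [W]. All neighbours in [W] of its end [z] lie on it;
   from the first of them, [c], the path closes up to a cycle [C] that contains them all. *)
set P := [:: x, v, y & p] in sub un nfull mx.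
set z := last y p in mx.
have paP : path e x [:: v, y & p] by [].
have zP : z \in P by rewrite /P /z 2!in_cons mem_last !orbT.
have zW : z \in W by apply: sub.
have hP : has (e z) P.
  have : 0 < #|nbrs W z| by rewrite reg // (ltn_trans _ k3).
  by case/card_gt0P=> w; rewrite inE => /andP[wW zw]; apply/hasP; exists w; first exact: mx.
have [p1 [c [p2 [eP zc np1]]]] : exists p1 c p2, [/\ P = p1 ++ c :: p2, e z c & ~~ has (e z) p1].
  by case: (split_find hP) => c p1 p2 zc np1; exists p1, c, p2; rewrite cat_rcons.
have sC : {subset c :: p2 <= P} by move=> w wC; rewrite eP mem_cat wC orbT.
have unC : uniq (c :: p2).
  have : uniq P by []. 
  by rewrite eP cat_uniq => /and3P[].
have zlast : last c p2 = z.
  have : last x P = z by [].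
  by rewrite eP last_cat.
have cyC : cycle e (c :: p2).
  rewrite /= rcons_path zlast zc andbT.
  have : sorted e P by [].
  by rewrite eP => /cat_sorted2[].
pose C := [set w in c :: p2].
have CW : C \subset W by apply/subsetP=> w; rewrite inE => /sC/sub.
have CP : C \proper W.
  rewrite properE CW; apply: contra nfull => WC; apply: (subset_trans WC).
  by apply/subsetP=> w; rewrite !inE => wC; have := sC w wC; rewrite !inE.
have [f fP] : colorable k (W :\: C).
  apply: IHsub; rewrite properE subsetDl; apply/subsetPn; exists c.
    by apply: (subsetP CW); rewrite !inE eqxx.
  by rewrite !inE eqxx.
pose Q w := [exists u in W :\: C, e w u].
have nQz : ~~ Q z.
  apply/existsP=> -[u /andP[]]; rewrite !inE => /andP[uC uW] zu.
  have := mx u uW zu; rewrite eP mem_cat in_cons (negPf uC) orbF => up1.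
  by case/hasP: np1; exists u.
have [hQ|nQ] := boolP (has Q (c :: p2)); last first.
  have [g gP] := IHsub C CP.
  rewrite -(setID W C) (setIidPr CW); apply: union_coloring gP fP _ => a b; rewrite inE => aC bW.
  by apply: contra nQ => ab; apply/hasP; exists a => //; apply/existsP; exists b; rewrite bW.
(* On the cycle, [a] has a neighbour [u] in [W] outside [C] and its successor [b] has none, so [b]
   may repeat the colour of [u]. The cycle is then coloured onwards from [b], and [a] comes last,
   seeing [u] and [b]. *)
have [|l1 [a [b [l2 [eC Qa nQb]]]]] := last_switch hQ; first by rewrite zlast.
have [u /andP[uWC au]] := existsP Qa.
have inC w : (w \in C) = [|| w \in l1, w == a, w == b | w \in l2].
  by rewrite inE eC mem_cat !inE.
have cyb : cycle e (b :: l2 ++ rcons l1 a).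
  move: cyC; rewrite eC -cat_rcons -(rot_cycle (size (rcons l1 a))) rot_size_cat.
  by rewrite cat_cons.
have unb : uniq (b :: l2 ++ rcons l1 a).
  by move: unC; rewrite eC -cat_rcons -(rot_uniq (size (rcons l1 a))) rot_size_cat cat_cons.
have bC : b \in C by rewrite inC eqxx !orbT.
have aC : a \in C by rewrite inC eqxx !orbT.
have bW : b \in W by apply: (subsetP CW).
have aW : a \in W by apply: (subsetP CW).
have [uC uW] : u \notin C /\ u \in W by move: uWC; rewrite in_setD => /andP[].
have ub : u != b by apply: contraNneq uC => ->.
pose g w := if w == b then f u else f w.
have gP : coloring k (b |: W :\: C) g.
  have bn w : w \in W :\: C -> ~~ e b w.
    by move=> wC; apply: contra nQb => bw; apply/existsP; exists w; rewrite wC.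
  have gf w : w \in W :\: C -> g w = f w.
    by rewrite /g; case: eqP => // ->; rewrite in_setD bC.
  have gb : g b = f u by rewrite /g eqxx.
  case: fP => f1 f2; split=> [w|w w'].
    by rewrite in_setU1 => /predU1P[->|wW]; rewrite ?gb ?gf //; apply: f1.
  rewrite !in_setU1 => /predU1P[->|wW] /predU1P[->|w'W].
  - by rewrite e_irr.
  - by rewrite (negPf (bn _ w'W)).
  - by rewrite e_sym (negPf (bn _ wW)).
  - by rewrite !gf //; apply: f2.
have subB : b |: W :\: C \subset W by rewrite subUset sub1set bW subsetDl.
have eq_r : rcons (l2 ++ l1) a = l2 ++ rcons l1 a by rewrite rcons_cat.
have memr w : w \in rcons (l2 ++ l1) a -> w \in C.
  by rewrite mem_rcons inC inE mem_cat => /or3P[]->; rewrite ?orbT.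
have [||||g1 g1P g01] := @path_coloring k W _ (l2 ++ l1) a _ deg subB gP.
- rewrite eq_r; move: cyb; rewrite /= rcons_path => /andP[/path_sorted].
  by [].
- by rewrite eq_r; case/andP: unb.
- by move=> w /memr /(subsetP CW).
- move=> w wr; rewrite in_setU1 in_setD (memr _ wr) orbF.
  by apply: contraTneq wr => ->; rewrite eq_r; case/andP: unb.
set A1 := _ :|: _ in g1P.
have uB : u \in b |: W :\: C by rewrite in_setU1 uWC orbT.
have bB : b \in b |: W :\: C by rewrite in_setU1 eqxx.
have BA w : w \in b |: W :\: C -> w \in A1 by move=> wB; apply/setUP; left.
have ab : e a b.
  have : sorted e (c :: p2) by move: cyC; rewrite /= rcons_path => /andP[].
  by rewrite eC => /cat_sorted2[_ /= /andP[]].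
have A1W : A1 \subset W.
  rewrite subUset subB; apply/subsetP=> w; rewrite inE => wl; apply: (subsetP CW); apply: memr.
  by rewrite mem_rcons inE wl orbT.
have [|||||||g2 g2P _] := @coloring_extend_eq k A1 a u b g1.
- rewrite in_setU in_setU1 in_setD aC orbF negb_or inE.
  have : uniq (rcons (l2 ++ l1) a) by rewrite eq_r; case/andP: unb.
  rewrite rcons_uniq => /andP[-> _]; rewrite andbT.
  by apply: contraTneq ab => ->; rewrite e_irr.
- exact: g1P.
- apply: leq_trans (deg a aW); apply/subset_leq_card/subsetP=> w; rewrite !in_set.
  by case/andP=> wA ->; rewrite andbT; apply: (subsetP A1W); rewrite !in_set.
- by rewrite inE au andbT BA.
- by rewrite inE ab andbT BA.
- by [].
- by rewrite -!g01 // /g eqxx (negPf ub).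
exists g2; apply: coloring_sub g2P; apply/subsetP=> w wW.
rewrite !in_setU !in_set1 in_setD wW andbT inC in_set mem_cat.
by case: (w == a); case: (w == b); case: (w \in l1); case: (w \in l2).
Qed.

End Coloring.

(** * Dense graphs without K_{1,s,t} *)

(** A point in k of the three sets lies in k(k-1)/2 of the intersections, and k <= 1 + k(k-1)/2. *)
Lemma card3_le (T : finType) (A B C : {set T}) :
  #|A| + #|B| + #|C| <= #|T| + (#|A :&: B| + #|B :&: C| + #|C :&: A|).
Proof.
have cE (S : {set T}) : #|S| = \sum_z (z \in S : nat) by rewrite -sum1_card big_mkcond.
rewrite -cardsT !cE -!big_split /=; apply: leq_sum => z _; rewrite !inE.
by case: (z \in A); case: (z \in B); case: (z \in C).
Qed.

(* An independent set of a 5-cycle has at most two elements. *)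
Lemma card5_le (T : finType) (A B C D E : {set T}) :
  #|A| + #|B| + #|C| + #|D| + #|E| <=
  2 * #|T| + (#|A :&: B| + #|B :&: C| + #|C :&: D| + #|D :&: E| + #|E :&: A|).
Proof.
have cE (S : {set T}) : #|S| = \sum_z (z \in S : nat) by rewrite -sum1_card big_mkcond.
rewrite -cardsT !cE big_distrr -!big_split /=; apply: leq_sum => z _; rewrite !inE.
by case: (z \in A); case: (z \in B); case: (z \in C); case: (z \in D); case: (z \in E).
Qed.

(** Injectivity across parts comes from irreflexivity, since vertices of distinct parts have
    adjacent images. *)
Lemma contains_tripartite (G : sgraph) s t (v : G) (S T : {set G}) :
  s <= #|S| -> t <= #|T| -> {in S, forall x, adj v x} -> {in T, forall y, adj v y} ->
  {in S & T, forall x y, adj x y} -> contains G (complete_tripartite 1 s t).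
Proof.
move=> sS tT vS vT ST.
pose f (x : complete_tripartite 1 s t) : G :=
  match x with
  | inl (inl _) => v
  | inl (inr i) => nth v (enum S) i
  | inr j => nth v (enum T) j
  end.
have fS (i : 'I_s) : nth v (enum S) i \in S.
  by rewrite -mem_enum mem_nth // -cardE (leq_trans (ltn_ord i)).
have fT (j : 'I_t) : nth v (enum T) j \in T.
  by rewrite -mem_enum mem_nth // -cardE (leq_trans (ltn_ord j)).
have fP : is_hom f.
  move=> [[i|i]|i] [[j|j]|j] //= _; first exact: vS.
  - exact: vT.
  - by rewrite adj_sym; apply: vS.
  - exact: ST.
  - by rewrite adj_sym; apply: vT.
  - by rewrite adj_sym; apply: ST.
exists f => // x y fxy; have nxy : ~~ adj x y.
  by apply/negP=> /fP; rewrite fxy adj_irr.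
case: x y fxy nxy => [[i|i]|i] [[j|j]|j] //=; first by rewrite !ord1.
  move/eqP; rewrite nth_uniq ?enum_uniq -?cardE ?(leq_trans (ltn_ord _)) //.
  by move=> /eqP/val_inj ->.
move/eqP; rewrite nth_uniq ?enum_uniq -?cardE ?(leq_trans (ltn_ord _)) //.
by move=> /eqP/val_inj ->.
Qed.

Section Neighbours.
Variable G : sgraph.
Local Notation nbrs := (nbrs (@adj G)).

Lemma sum_nbrs (U P : {set G}) :
  \sum_(u in U) #|nbrs P u| = \sum_(y in P) #|nbrs U y|.
Proof.
have cE (S : {set G}) x : #|nbrs S x| = \sum_(y in S) adj x y.
  by rewrite -sum1_card big_mkcond [RHS]big_mkcond;
    apply: eq_bigr => y _; rewrite inE; case: (y \in S).
under eq_bigr do rewrite cE; under [RHS]eq_bigr do rewrite cE.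
by rewrite exchange_big; apply: eq_bigr => y _; apply: eq_bigr => x _; rewrite adj_sym.
Qed.

(** Double counting: at most [K] exceptional vertices of [P] contribute up to |U|, all others at
    most [r]. *)
Lemma sum_nbrs_le (U P : {set G}) r K :
  #|[set y in P | r < #|nbrs U y|]| <= K ->
  \sum_(u in U) #|nbrs P u| <= r * #|P| + #|U| * K.
Proof.
set B := [set y in P | _] => BK; rewrite sum_nbrs.
have BP : B \subset P by apply/subsetP=> y; rewrite inE => /andP[].
apply: leq_trans (_ : \sum_(y in P) (r + (if y \in B then #|U| else 0)) <= _).
  apply: leq_sum => y yP; rewrite inE yP /=; case: ltnP => [_|]; last by rewrite addn0.
  by apply: leq_trans (leq_addl _ _); apply/subset_leq_card/subsetP=> z; rewrite inE => /andP[].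
rewrite big_split sum_nat_const mulnC leq_add2l -big_mkcondr /=.
rewrite (eq_bigl (mem B)) => [|y]; first by rewrite sum_nat_const mulnC leq_mul2l BK orbT.
by rewrite andb_idl //; apply: (subsetP BP).
Qed.

Variables s t : nat.
Hypothesis Gfree : Defs.free (complete_tripartite 1 s t) G.

(** A subset of [U] of order at least s has at most t common neighbours in [P], since more would
    give K_{1,s,t} with centre [v]; and [U] has at most 2^D subsets. *)
Lemma few_common v (U P : {set G}) D :
  #|U| <= D -> {in U, forall u, adj v u} -> {in P, forall y, adj v y} ->
  #|[set y in P | s <= #|nbrs U y|]| <= t * 2 ^ D.
Proof.
move=> UD vU vP.
pose I := [set S in powerset U | s <= #|S|].
pose B (S : {set G}) := [set y in P | S \subset nbrs U y].
apply: leq_trans (_ : #|\bigcup_(S in I) B S| <= _).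
  apply/subset_leq_card/subsetP=> y; rewrite inE => /andP[yP sy].
  apply/bigcupP; exists (nbrs U y); last by rewrite !inE yP subxx.
  by rewrite !inE sy andbT; apply/subsetP=> z; rewrite inE => /andP[].
apply: leq_trans (_ : \sum_(S in I) t <= _).
  elim/big_rec2: _ => [|S m Q]; first by rewrite cards0.
  rewrite !inE => /andP[/subsetP SU sS] QM.
  apply: leq_trans (leq_card_setU _ _) _; apply: leq_add => //.
  rewrite leqNgt; apply/negP=> /ltnW tB; apply: Gfree.
  apply: (contains_tripartite sS tB) => [x /SU|y|x y xS]; first exact: vU.
    by rewrite inE => /andP[/vP].
  by rewrite inE adj_sym => /andP[_ /subsetP/(_ x xS)]; rewrite inE => /andP[].
rewrite sum_nat_const mulnC leq_mul2l; apply/orP; right.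
apply: leq_trans (_ : #|powerset U| <= _).
  by apply/subset_leq_card/subsetP=> S; rewrite inE => /andP[].
by rewrite card_powerset leq_exp2l.
Qed.

End Neighbours.

(* Here c = s - 1, d = t - s, and s - 1 + a, s - 1 + b are the maximum degrees
   inside the two classes, of sizes x and y. *)
Lemma star_degrees_arith c d q n x y a b r D C :
  0 < c -> (1 + d) * c + r * d <= r * c -> r <= a + b -> x + y <= n ->
  c + a <= D -> c + b <= D -> 2 * D * C < n ->
  (c + 2 * a) * ((q * (c + 1) + 1) * n) <= (c + a) * (q * (2 * (c + 1) + 1 + d) * y) + C ->
  (c + 2 * b) * ((q * (c + 1) + 1) * n) <= (c + b) * (q * (2 * (c + 1) + 1 + d) * x) + C ->
  False.
Proof.
move=> c0 rP rab xyn wD zD nC Ha Hb.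
have dc : d < c by nia.
have abP : (1 + d) * c + (a + b) * d <= (a + b) * c by nia.
(* The two sides differ by [c] times [abP] together with (1 + d) ab <= 2 (c + 1) ab. *)
have key : (1 + d) * ((c + a) * (c + b)) <= (c + 1) * (a * (c + b) + b * (c + a)).
  have : c * ((1 + d) * c + (a + b) * d) <= c * ((a + b) * c) by rewrite leq_mul2l abP orbT.
  have : (1 + d) * (a * b) <= 2 * (c + 1) * (a * b) by rewrite leq_mul2r; apply/orP; right; lia.
  clear; lia.
set w := c + a in Ha wD key; set z := c + b in Hb zD key.
have {}Ha : z * ((c + 2 * a) * ((q * (c + 1) + 1) * n)) <=
   z * (w * (q * (2 * (c + 1) + 1 + d) * y) + C) by rewrite leq_mul2l Ha orbT.
have {}Hb : w * ((c + 2 * b) * ((q * (c + 1) + 1) * n)) <=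
   w * (z * (q * (2 * (c + 1) + 1 + d) * x) + C) by rewrite leq_mul2l Hb orbT.
have xyn' : w * z * (q * (2 * (c + 1) + 1 + d)) * (x + y) <=
   w * z * (q * (2 * (c + 1) + 1 + d)) * n by rewrite leq_mul2l xyn orbT.
have key' : q * n * ((1 + d) * (w * z)) <= q * n * ((c + 1) * (a * z + b * w)).
  by rewrite leq_mul2l key orbT.
(* In z times [Ha] plus w times [Hb], with x + y <= n, the terms with the factor q are absorbed by
   [key]; what remains comes from the surplus 1 in q (c + 1) + 1. *)
have small : (2 * (w * z) + a * z + b * w) * n <= (z + w) * C.
  have ew : c + 2 * a = w + a by rewrite /w; lia.
  have ez : c + 2 * b = z + b by rewrite /z; lia.
  rewrite ew ez in Ha Hb; move: Ha Hb xyn' key'; clear; lia.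
have wz : 0 < w * z by rewrite muln_gt0 !addn_gt0 c0.
have : n <= (2 * (w * z) + a * z + b * w) * n by rewrite leq_pmull //; move: wz; clear; lia.
have : (z + w) * C <= 2 * D * C by rewrite leq_mul2r; apply/orP; right; lia.
by move: small nC; clear; lia.
Qed.

(** * Closeness classes, inner degrees and cliques of a dense graph *)

Section DenseGraph.
Variables (s t q : nat) (G : sgraph).
Local Notation h := (1 + s + t).
Local Notation A := (q * (1 + s + t)).
Local Notation n := #|G|.
Local Notation nbrs := (nbrs (@adj G)).
Local Notation N := (nbrs [set: G]).
Let D := 2 * A * s.
Let K := t * 2 ^ D.
Hypotheses (s_gt0 : 0 < s) (q_gt0 : 0 < q).
Hypothesis Gfree : Defs.free (complete_tripartite 1 s t) G.
Hypothesis degG : forall v : G, (q * s + 1) * n <= A * degree v.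

Let degE v : degree v = #|N v|.
Proof. by apply: eq_card => w; rewrite !inE. Qed.

Lemma nbrs_split (X : {set G}) v : #|N v| = #|nbrs X v| + #|nbrs (~: X) v|.
Proof.
rewrite -(cardsID X (N v)); congr (_ + _); apply: eq_card => w; rewrite !inE //.
by rewrite andbC.
Qed.

(* The degree hypothesis says that degrees are at least (s + 1/q) n / h; the
   surplus n / A over s n / h is also the threshold for closeness. *)
Definition close (u v : G) := n <= A * #|N u :&: N v|.

Lemma close_sym u v : close u v = close v u.
Proof. by rewrite /close setIC. Qed.

Hypothesis n_large : 2 * A * K < n.

(** The degrees into [N v] of D close neighbours of [v] would sum to at least D n / A = 2 s n, but
    all but [K] vertices of [N v] see at most s - 1 of these neighbours. *)
Lemma close_nbrs v : #|[set u in N v | close u v]| < D.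
Proof.
rewrite ltnNge; apply/negP=> DC.
have [r [r_uniq r_size r_sub]] := card_geqP DC.
pose U := [set u in r].
have cU : #|U| = D by rewrite cardsE -r_size; apply/card_uniqP.
have UC u : u \in U -> adj v u /\ close u v.
  by rewrite inE => /r_sub; rewrite !inE => /andP[].
have few : #|[set y in N v | s.-1 < #|nbrs U y|]| <= K.
  rewrite prednK //; apply: (few_common Gfree (v := v)) => [|u /UC[] //|u]; first by rewrite cU.
  by rewrite !inE.
have := sum_nbrs_le few; rewrite cU.
have : D * n <= A * \sum_(u in U) #|nbrs (N v) u|.
  rewrite -cU big_distrr -sum_nat_const; apply: leq_sum => u /UC[_].
  by rewrite /close (eq_card (B := nbrs (N v) u)) // => w; rewrite !inE andbC.
have : #|N v| <= n by apply: max_card.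
move: (\sum_(u in U) _) #|N v| => S d dn DS SK.
have A_gt0 : 0 < A by rewrite muln_gt0 q_gt0.
have As_gt0 : 0 < A * s by rewrite muln_gt0 A_gt0.
suff : A * s * n <= A * s * (2 * A * K) by rewrite leq_pmul2l // leqNgt n_large.
have : A * S <= A * (s * n + D * K).
  rewrite leq_mul2l (leq_trans SK) ?orbT // leq_add2r leq_mul ?leq_pred //.
move: DS; clear -D; rewrite /D; move: A n K S => a m k S; clear; lia.
Qed.

Hypothesis n_large2 : 2 * A * D < n.
Hypothesis hs : 2 * h <= 5 * s.

Let A_gt0 : 0 < A. Proof. by rewrite muln_gt0 q_gt0. Qed.

Let hsA : 2 * A * n <= 5 * (q * s) * n.
Proof.
by rewrite leq_mul2r mulnCA [leqRHS]mulnCA leq_mul2l hs !orbT.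
Qed.

Let degN v : (q * s + 1) * n <= A * #|N v|.
Proof. by rewrite -degE. Qed.

(** Of the more than 2D common neighbours, fewer than D are close to [u] and fewer than D to [v]. *)
Lemma far_nbr u v : close u v ->
  exists p, [/\ p \in N u, p \in N v, ~~ close p u & ~~ close p v].
Proof.
move=> uv; pose B v := [set u in N v | close u v].
have : ~~ (N u :&: N v \subset B u :|: B v).
  apply/negP=> /subset_leq_card; apply/negP; rewrite -ltnNge.
  apply: leq_ltn_trans (leq_card_setU _ _) _.
  have := close_nbrs u; have := close_nbrs v; rewrite -/(B u) -/(B v) => Bu Bv.
  rewrite -(ltn_pmul2l A_gt0); apply: leq_trans uv; apply: leq_ltn_trans n_large2.
  move: Bu Bv; move: D A #|B u| #|B v| => d a b c; clear; nia.
case/subsetPn=> p; rewrite in_setI => /andP[pu pv].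
have := (pu, pv); rewrite !inE => -[-> ->]; rewrite !andTb negb_or => /andP[npu npv].
by exists p.
Qed.

(** Five neighbourhoods of order at least 2n/5 + n/A sum to 2n + 5n/A, more than five overlaps below
    n/A along a 5-cycle allow. *)
Lemma close_trans u v w : close u v -> close v w -> close u w.
Proof.
move=> uv vw; apply/negPn/negP=> nuw.
have [p [pu pv npu npv]] := far_nbr uv.
have [r [rv rw nrv nrw]] := far_nbr vw.
(* In the cyclic order u, w, r, v, p consecutive vertices are not close. *)
have := leq_mul (leqnn A) (card5_le (N u) (N w) (N r) (N v) (N p)).
move: nuw nrw nrv npv npu (degN u) (degN v) (degN w) (degN p) (degN r) hsA.
rewrite /close -!ltnNge (setIC (N w)) (setIC (N v) (N p)) !mulnDr.
move: (A * #|N u :&: N w|) (A * #|N r :&: N w|) (A * #|N r :&: N v|).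
move: (A * #|N p :&: N v|) (A * #|N p :&: N u|).
move: (A * #|N u|) (A * #|N v|) (A * #|N w|) (A * #|N p|) (A * #|N r|) n A.
move: s q; clear; lia.
Qed.

(** Three pairwise almost disjoint neighbourhoods of order above 2n/5 do not fit into n vertices. *)
Lemma close_three u v w : [|| close u v, close v w | close w u].
Proof.
apply/negPn; rewrite !negb_or; apply/negP=> /and3P[uv vw wu].
have := leq_mul (leqnn A) (card3_le (N u) (N v) (N w)).
move: uv vw wu (degN u) (degN v) (degN w) hsA; rewrite /close -!ltnNge !mulnDr.
move: (A * #|N u :&: N v|) (A * #|N v :&: N w|) (A * #|N w :&: N u|).
move: (A * #|N u|) (A * #|N v|) (A * #|N w|) n A.
move: s q; clear; lia.
Qed.

Definition sparse (X : {set G}) := {in X, forall v, #|nbrs X v| < D}.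

(** The parts are the class of some [v0] and the rest, whose members are pairwise close by
    [close_three]; [close_nbrs] makes both sparse. *)
Lemma sparse_partition : exists X, sparse X /\ sparse (~: X).
Proof.
have [v0 _] : exists v0 : G, v0 \in G by apply/card_gt0P; apply: leq_ltn_trans n_large.
have clP (X : {set G}) : {in X &, forall u v, close u v} -> sparse X.
  move=> cX v vX; apply: leq_ltn_trans (close_nbrs v).
  by apply/subset_leq_card/subsetP=> u; rewrite !inE => /andP[uX ->]; rewrite cX.
exists [set v | close v v0]; split; apply: clP => u v; rewrite !inE => uv0 vv0.
  by apply: close_trans uv0 _; rewrite close_sym.
have := close_three u v v0; rewrite (negPf vv0) close_sym => /orP[|].
  by rewrite close_sym.
by rewrite close_sym (negPf uv0).
Qed.

Let dG := (q * s + 1) * n.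

Lemma sparse_cross X v : sparse X -> v \in X -> dG <= A * #|nbrs (~: X) v| + A * D.
Proof.
move=> spX vX; apply: leq_trans (degN v) _; rewrite -mulnDr leq_mul2l (nbrs_split X).
by rewrite (addnC #|nbrs X v|) leq_add2l ltnW ?orbT ?spX.
Qed.

(** Edges between the neighbours [U] of [v] in [X] and its neighbours [P] outside are counted from
    both ends: all but [K] vertices of [P] see at most s - 1 vertices of [U], while a vertex of [U]
    misses no more of [P] than of the whole complement of [X]. *)
Lemma star_bound X v a : sparse X -> v \in X -> #|nbrs X v| = s.-1 + a ->
  (s.-1 + 2 * a) * dG <= (s.-1 + a) * (A * #|~: X|) + (A * D * K + 2 * A * D * D).
Proof.
move=> spX vX; set U := nbrs X v; set P := nbrs (~: X) v => Um.
have UD : #|U| <= D by rewrite ltnW ?spX.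
have few : #|[set y in P | s.-1 < #|nbrs U y|]| <= K.
  rewrite prednK //; apply: (few_common Gfree (v := v)) => // u; rewrite inE; by case/andP.
have PY : P \subset ~: X by apply/subsetP=> y; rewrite inE => /andP[].
have low : #|U| * (dG + A * #|P|) <=
    A * \sum_(u in U) #|nbrs P u| + #|U| * (A * #|~: X| + A * D).
  rewrite big_distrr -!sum_nat_const -big_split; apply: leq_sum => u; rewrite inE => /andP[uX _] /=.
  apply: leq_trans (leq_add (sparse_cross spX uX) (leqnn _)) _.
  rewrite addnAC addnA leq_add2r -!mulnDr leq_mul2l; apply/orP; right.
  rewrite -cardsUI addnC; apply: leq_add; apply/subset_leq_card/subsetP=> y; rewrite !inE.
    by case/andP=> /andP[_ ->] /andP[-> ->].
  by case/orP=> /andP[].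
have high := leq_mul (leqnn A) (sum_nbrs_le few).
have {}low := leq_trans low (leq_add high (leqnn _)).
have cross := leq_mul (leqnn a) (sparse_cross spX vX); rewrite -/P in cross.
have mK : A * #|U| * K <= A * D * K by rewrite leq_mul2r leq_mul2l UD !orbT.
have mD : A * #|U| * D <= A * D * D by rewrite leq_mul2r leq_mul2l UD !orbT.
have aD : A * a * D <= A * #|U| * D by rewrite leq_mul2r leq_mul2l Um leq_addl !orbT.
rewrite Um in low mK mD aD *; move: low cross mK mD aD.
clear Um; move: s.-1 a dG A #|P| #|~: X| D K; clear => c a d m p y D K.
rewrite !mulnDr !mulnDl; lia.
Qed.

(** A vertex outside [X] that sees more than s vertices of the clique sees s of them besides some
    neighbour [v] among them; [few_common] with centre [v] leaves at most D K such vertices. *)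
Lemma clique_bound (X C : {set G}) : sparse X -> C \subset X ->
  {in C &, forall x y, x != y -> adj x y} ->
  #|C| * dG <= s * (A * #|~: X|) + (A * D * D * K + A * D * D).
Proof.
move=> spX CX clC; have sub v : v \in C -> C :\ v \subset nbrs X v.
  move=> vC; apply/subsetP=> u; rewrite !inE => /andP[uv uC].
  by rewrite (subsetP CX) //= clC // eq_sym.
have CD : #|C| <= D.
  have [->|[v vC]] := set_0Vmem C; first by rewrite cards0.
  rewrite (cardsD1 v) vC; apply: leq_ltn_trans (spX v (subsetP CX v vC)).
  exact/subset_leq_card/sub.
have few : #|[set y in ~: X | s < #|nbrs C y|]| <= D * K.
  pose B v := [set y in nbrs (~: X) v | s <= #|nbrs (C :\ v) y|].
  apply: leq_trans (_ : #|\bigcup_(v in C) B v| <= _).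
    apply/subset_leq_card/subsetP=> y; rewrite inE => /andP[yX sC].
    have [v] : exists v, v \in nbrs C y by apply/card_gt0P; apply: leq_ltn_trans sC.
    rewrite inE => /andP[vC yv]; apply/bigcupP; exists v => //.
    rewrite inE inE yX adj_sym yv /=; move: sC; rewrite (cardsD1 v) inE vC yv ltnS => sC.
    apply: leq_trans sC _; apply/subset_leq_card/subsetP=> z.
    by rewrite !inE => /and3P[-> -> ->].
  apply: leq_trans (_ : \sum_(v in C) K <= _); last by rewrite sum_nat_const leq_mul2r CD orbT.
  elim/big_rec2: _ => [|v m Q vC QM]; first by rewrite cards0.
  apply: leq_trans (leq_card_setU _ _) _; apply: leq_add => //.
  apply: (few_common Gfree (v := v)) => [|u /(subsetP (sub v vC))|y]; rewrite ?inE.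
  - by apply: leq_trans (subset_leq_card (sub v vC)) (ltnW (spX _ (subsetP CX v vC))).
  - by case/andP.
  - by case/andP.
have low : #|C| * dG <= A * \sum_(u in C) #|nbrs (~: X) u| + #|C| * (A * D).
  rewrite big_distrr -!sum_nat_const -big_split; apply: leq_sum => u uC /=.
  exact: sparse_cross (subsetP CX u uC).
have high := leq_mul (leqnn A) (sum_nbrs_le few).
apply: leq_trans low (leq_trans (leq_add high (leqnn _)) _).
have CD2 : #|C| * (A * D) <= D * (A * D) by rewrite leq_mul2r CD orbT.
have CD3 : #|C| * (A * D * K) <= D * (A * D * K) by rewrite leq_mul2r CD orbT.
move: CD2 CD3; move: s A #|~: X| #|C| D K; clear => s m y c D K.
rewrite !mulnDr; lia.
Qed.

Let C1 := A * D * K + 2 * A * D * D.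

(** The witness is the excess of the maximum degree inside [X] over s - 1, or 0 if that degree is at
    most s - 1. *)
Lemma excess_bound (X : {set G}) : sparse X ->
  exists a, [/\ {in X, forall v, #|nbrs X v| <= s.-1 + a}, s.-1 + a <= D
    & (s.-1 + 2 * a) * dG <= (s.-1 + a) * (A * #|~: X|) + C1].
Proof.
move=> spX; have sD : s.-1 <= D by apply: leq_trans (leq_pred s) (leq_pmull _ _); rewrite muln_gt0.
case: (pickP [pred v in X | s.-1 < #|nbrs X v|]) => [v0 /= /andP[v0X sv0]|small].
  have [v vX vmax] := arg_maxnP (fun v => #|nbrs X v|) v0X.
  have sv : s.-1 <= #|nbrs X v| by apply: leq_trans (ltnW sv0) (vmax _ v0X).
  exists (#|nbrs X v| - s.-1); rewrite subnKC //; split=> //; first by rewrite ltnW ?spX.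
  have := @star_bound X v (#|nbrs X v| - s.-1) spX vX; rewrite subnKC // => ->//.
exists 0; rewrite !addn0; split=> // [v vX|].
  by rewrite leqNgt; have /= := small v; rewrite vX /= => ->.
have cross : dG <= A * #|~: X| + A * D.
  have [X0|[v vX]] := set_0Vmem X.
    have [v _] : exists v0 : G, v0 \in G by apply/card_gt0P; apply: leq_ltn_trans n_large.
    apply: leq_trans (degN v) (leq_trans _ (leq_addr _ _)).
    by rewrite leq_mul2l X0 setC0 subset_leq_card ?orbT ?subsetT.
  apply: leq_trans (sparse_cross spX vX) _; rewrite leq_add2r leq_mul2l subset_leq_card ?orbT //.
  by apply/subsetP=> y; rewrite inE => /andP[].
apply: leq_trans (leq_mul (leqnn _) cross) _; rewrite mulnDr leq_add2l /C1.
apply: leq_trans (leq_addl _ _); apply: leq_trans (leq_mul sD (leqnn _)) _.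
by move: A D; clear; lia.
Qed.

Hypothesis n_large3 : 2 * D * C1 < n.
Hypothesis n_large4 : 2 * (A * D * D * K + A * D * D) < n.
Hypotheses (s_le_t : s <= t) (hd : (t - s + 1) ^ 2 <= s) (hs2 : 2 + 2 * t <= 3 * s).

Definition big_clique (X : {set G}) p :=
  [exists C : {set G}, [&& C \subset X, p < #|C| &
    [forall x in C, forall y in C, (x != y) ==> adj x y]]].

(** The two clique bounds add up to (|C| + |C'|) [dG] <= s A n plus an error below n, whereas (1 + s
    + t) [dG] = s A n + (1 + s + t) n. *)
Lemma no_two_big_cliques (X : {set G}) p p' : sparse X -> sparse (~: X) ->
  1 + s + t <= p.+1 + p'.+1 -> ~~ (big_clique X p && big_clique (~: X) p').
Proof.
move=> spX spY pp; apply/negP=> /andP[/existsP[C /and3P[CX pC /forall_inP cC]]].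
case/existsP=> C' /and3P[CX' pC' /forall_inP cC'].
have := clique_bound spX CX (fun x y xC yC => implyP (forall_inP (cC x xC) y yC)).
have := clique_bound spY CX' (fun x y xC yC => implyP (forall_inP (cC' x xC) y yC)).
rewrite setCK => B' B; have {B B'} := leq_add B B'.
have : h * dG <= (#|C| + #|C'|) * dG.
  by rewrite leq_mul2r (leq_trans pp) ?orbT // leq_add.
have : n = #|X| + #|~: X| by rewrite cardsC.
move: n_large4; rewrite /dG -mulnDl; move: (A * D * D * K + A * D * D) => C2.
move: n #|X| #|~: X| (_ + #|C'|) => m x y cc; clear; nia.
Qed.

Lemma Brooks_side (X : {set G}) p : 2 < p -> {in X, forall v, #|nbrs X v| <= p} ->
  ~~ big_clique X p -> colorable (@adj G) p X.
Proof.
move=> p2 degX nbig; apply: (Brooks (@adj_sym G) (@adj_irr G) p2 degX) => C CX cC.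
rewrite leqNgt; apply: contra nbig => pC; apply/existsP; exists C; rewrite CX pC /=.
by apply/forall_inP=> x xC; apply/forall_inP=> y yC; apply/implyP; apply: cC.
Qed.

Lemma dense_colorable : colorable (@adj G) (s + t) [set: G].
Proof.
have [X [spX spY]] := sparse_partition.
have [a [degX aD Ha]] := excess_bound spX.
have [b [degY bD Hb]] := excess_bound spY.
pose d := t - s; have hd' : (d + 1) ^ 2 <= s by [].
have td : t = s + d by rewrite /d; lia.
have sc : s = s.-1 + 1 by rewrite addn1 prednK.
have c0 : 0 < s.-1 by lia.
rewrite setCK in Hb.
have hE : 1 + s + t = 2 * (s.-1 + 1) + 1 + d by lia.
(* An admissible r bounds a + b: r = d + 2 is admissible because (d + 1)^2 <= s, and r = 1 is if d =
   0. *)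
have noab r : (1 + d) * s.-1 + r * d <= r * s.-1 -> a + b < r.
  move=> rP; rewrite ltnNge; apply/negP=> rab.
  apply: (@star_degrees_arith s.-1 d q n #|X| #|~: X| a b r D C1) => //.
  - by rewrite cardsC.
  - by rewrite -hE -sc.
  - by rewrite -hE -sc.
have colX : colorable (@adj G) (s + a) X.
  by apply: (greedy_coloring (@adj_sym G) (@adj_irr G)) => v /degX; lia.
have colY : colorable (@adj G) (s + b) (~: X).
  by apply: (greedy_coloring (@adj_sym G) (@adj_irr G)) => v /degY; lia.
have [abd|abd] := leqP (a + b) d.
  by apply: colorableW (colorable_setC colX colY); lia.
have d0 : 0 < d.
  rewrite lt0n; apply/negP=> /eqP d0; have := noab 1; rewrite d0; lia.
have ab : a + b = d.+1.
  have : a + b < d.+2.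
    apply: noab; move: hd'; rewrite -mulnn [X in _ <= X]sc; move: s.-1; clear; lia.
  by move: abd; clear; lia.
have s4 : 3 < s by apply: leq_trans hd'; move: d0; clear; case: d => // k _; rewrite -mulnn; lia.
(* Cliques of orders s + a and s + b would have 1 + s + t vertices in total, so on one side Brooks'
   theorem saves a colour. *)
have := @no_two_big_cliques X (s.-1 + a) (s.-1 + b) spX spY; rewrite negb_and.
case/(_ _)/orP; first by lia.
  move/(Brooks_side _ degX) => cX.
  by apply: colorableW (colorable_setC (cX _) colY); lia.
move/(Brooks_side _ degY) => cY.
by apply: colorableW (colorable_setC colX (cY _)); lia.
Qed.

End DenseGraph.

(** * The upper bound *)

Lemma min_degree_le (G : sgraph) (v : G) : min_degree G <= degree v.
Proof.
rewrite /min_degree; have := mem_index_enum v; elim: (index_enum G) => // u r IH.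
rewrite inE big_cons => /predU1P[->|/IH]; first exact: geq_minl.
by apply: leq_trans; apply: geq_minr.
Qed.

Lemma le_min_degree (G : sgraph) k :
  k <= #|G| -> (forall v : G, k <= degree v) -> k <= min_degree G.
Proof.
move=> kG kd; rewrite /min_degree; elim/big_ind: _ => // m m' km km'.
by rewrite leq_min km.
Qed.

Lemma neq_sym (T : eqType) : symmetric (fun x y : T => x != y).
Proof. by move=> x y; rewrite eq_sym. Qed.

Lemma neq_irr (T : eqType) : irreflexive (fun x y : T => x != y).
Proof. by move=> x; rewrite eqxx. Qed.

Definition complete_graph n : sgraph := SGraph (@neq_sym 'I_n) (@neq_irr 'I_n).

Lemma card_complete_tripartite a b c : #|complete_tripartite a b c| = a + b + c.
Proof. by rewrite !card_sum !card_ord. Qed.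

Lemma complete_graph_free s t : Defs.free (complete_tripartite 1 s t) (complete_graph (s + t)).
Proof.
move=> [f f_inj _]; have := leq_card f f_inj.
by rewrite card_complete_tripartite card_ord -addnA ltnn.
Qed.

Lemma colorable_homomorphic (G : sgraph) k :
  colorable (@adj G) k [set: G] -> homomorphic G (complete_graph k).
Proof.
move=> [f [f_lt f_ne]]; exists (fun x => Ordinal (f_lt x (in_setT x))) => x y xy.
by rewrite /= -val_eqE /= f_ne.
Qed.

(** The degree condition expresses the ratio (s + 1/q) / (1 + s + t) in integers; the bound on the
    order collects the size conditions of the dense case. *)
Lemma dense_homomorphic s t q : 0 < s -> s <= t -> 0 < q ->
  (t - s + 1) ^ 2 <= s -> 2 + 2 * t <= 3 * s ->
  exists N, forall G : sgraph, Defs.free (complete_tripartite 1 s t) G -> N <= #|G| ->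
    (forall v : G, (q * s + 1) * #|G| <= q * (1 + s + t) * degree v) ->
    homomorphic G (complete_graph (s + t)).
Proof.
move=> s0 st q0 hd hs.
pose A := q * (1 + s + t); pose D := 2 * A * s; pose K := t * 2 ^ D.
exists (2 * A * K + 2 * A * D + 2 * D * (A * D * K + 2 * A * D * D)
  + 2 * (A * D * D * K + A * D * D)).+1 => G Gfree; rewrite -/A => nG degG.
apply/colorable_homomorphic/(@dense_colorable s t q) => //.
- by apply: leq_ltn_trans nG; rewrite -!addnA leq_addr.
- apply: leq_ltn_trans nG; do 2! apply: leq_trans (leq_addr _ _); exact: leq_addl.
- by move: hs; clear; lia.
- apply: leq_ltn_trans nG; apply: leq_trans (leq_addr _ _); exact: leq_addl.
- apply: leq_ltn_trans nG; exact: leq_addl.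
Qed.

(** * Finite disjoint unions of graphs *)

Section DisjointUnion.
Variables (I : finType) (F : I -> sgraph).

Definition union_adj : rel {i : I & F i} :=
  fun u v => (tag u == tag v) && adj (tagged u) (tagged_as u v).

Lemma union_adj_sym : symmetric union_adj.
Proof.
move=> [i x] [j y]; rewrite /union_adj /= eq_sym; case: eqP => //= ij; subst j.
by rewrite !tagged_asE adj_sym.
Qed.

Lemma union_adj_irr : irreflexive union_adj.
Proof. by move=> [i x]; rewrite /union_adj tagged_asE adj_irr andbF. Qed.

Definition disjoint_union : sgraph := SGraph union_adj_sym union_adj_irr.

Lemma homomorphic_union (G : sgraph) i : homomorphic G (F i) -> homomorphic G disjoint_union.
Proof.
move=> [f fP]; exists (fun x => Tagged F (f x)) => x y /fP.
by rewrite /= /union_adj eqxx tagged_asE.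
Qed.

(** A vertex adjacent to all others pins a copy of [H] to one component. *)
Lemma disjoint_union_free (H : sgraph) (c : H) :
  (forall x : H, x != c -> adj c x) -> (forall i, Defs.free H (F i)) ->
  Defs.free H disjoint_union.
Proof.
move=> cP Ffree [f f_inj fP]; apply: (Ffree (tag (f c))).
have tagc x : tag (f c) = tag (f x).
  have [->//|xc] := eqVneq x c.
  by have /andP[/eqP] := fP _ _ (cP x xc).
exists (fun x => tagged_as (f c) (f x)) => [x y exy|x y /fP /andP[_]].
  apply: f_inj; move: (tagc x) (tagc y) exy; rewrite /tagged_as.
  case: (f c) => i u; case: (f x) => j v; case: (f y) => k w /= e1 e2; subst j k.
  case: eqP => // e; rewrite eq_axiomK /=.
  by move=> evw; congr existT; exact: evw.
move: (tagc x) (tagc y); rewrite /tagged_as.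
case: (f c) => i u; case: (f x) => j v; case: (f y) => k w /= e1 e2; subst j k.
by case: eqP => // e; rewrite eq_axiomK.
Qed.

End DisjointUnion.

(** * A finite family containing all small graphs *)

Section SmallGraphs.
Variables (H F0 : sgraph) (N : nat).

Definition code_adj k (r : {ffun 'I_k * 'I_k -> bool}) : rel 'I_k := fun x y => r (x, y).

Definition code_graph k (r : {ffun 'I_k * 'I_k -> bool}) : sgraph :=
  match pselect (symmetric (code_adj r)), pselect (irreflexive (code_adj r)) with
  | left r_sym, left r_irr => SGraph r_sym r_irr
  | _, _ => F0
  end.

(** This family over a finite type contains, up to isomorphism, every H-free graph of order below
    [N]. Unsuitable codes and [None] yield [F0], later the K_{s+t} to which large graphs map. *)
Definition small_graph (i : option {k : 'I_N & {ffun 'I_k * 'I_k -> bool}}) : sgraph :=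
  if i is Some (existT k r) then
    if `[< Defs.free H (code_graph r) >] then code_graph r else F0
  else F0.

Lemma small_graph_free : Defs.free H F0 -> forall i, Defs.free H (small_graph i).
Proof. by move=> F0free [[k r]|] //=; case: asboolP. Qed.

Lemma homomorphic_small_graph (G : sgraph) : Defs.free H G -> #|G| < N ->
  exists i, homomorphic G (small_graph i).
Proof.
move=> Gfree GN; pose k := Ordinal GN.
pose r : {ffun 'I_k * 'I_k -> bool} := [ffun p => adj (enum_val p.1) (enum_val p.2)].
exists (Some (existT _ k r)) => /=.
have r_sym : symmetric (code_adj r) by move=> x y; rewrite /code_adj !ffunE adj_sym.
have r_irr : irreflexive (code_adj r) by move=> x; rewrite /code_adj !ffunE adj_irr.
have -> : code_graph r = SGraph r_sym r_irr.
  rewrite /code_graph; case: pselect => // p; case: pselect => // p'.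
  by rewrite (Prop_irrelevance p r_sym) (Prop_irrelevance p' r_irr).
case: asboolP => [_|[]].
  by exists (@enum_rank G) => x y xy; rewrite /= /code_adj ffunE /= !enum_rankK.
move=> [f f_inj fP]; apply: Gfree; exists (@enum_val G predT \o f).
  exact: inj_comp enum_val_inj f_inj.
by move=> x y /fP; rewrite /= /code_adj ffunE.
Qed.

End SmallGraphs.

Local Open Scope ring_scope.

Lemma hom_bounding_above (R : realType) s t (gamma : R) : (0 < s)%N -> (s <= t)%N ->
  ((t - s + 1) ^ 2 <= s)%N -> (2 + 2 * t <= 3 * s)%N ->
  s%:R / (1 + s + t)%:R < gamma -> hom_bounding R (complete_tripartite 1 s t) gamma.
Proof.
move=> s0 st hd hs lt_g; set h := (1 + s + t)%N in lt_g *.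
have h0 : 0 < h%:R :> R by rewrite ltr0n.
have g0 : 0 <= gamma by apply: ltW; apply: le_lt_trans lt_g; rewrite divr_ge0.
set H := complete_tripartite 1 s t.
(* The integral degree condition needs gamma (1 + s + t) >= s + 1/q, hence q > 1/e. *)
pose e := gamma * h%:R - s%:R.
have e0 : 0 < e by rewrite subr_gt0 -ltr_pdivrMr.
pose q := (Num.truncn (e^-1)).+1.
have q_e : 1 < q%:R * e.
  by rewrite -ltr_pdivrMr // div1r; apply: truncnS_gt.
have [N NP] := @dense_homomorphic s t q s0 st isT hd hs.
pose F0 := complete_graph (s + t).
split=> //; exists (disjoint_union (@small_graph H F0 N)).
  pose c : H := inl (inl ord0).
  apply: (@disjoint_union_free _ _ _ c); first by move=> [[i|i]|i] //; rewrite ord1.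
  exact/small_graph_free/complete_graph_free.
move=> G Gfree degG; case: (ltnP #|G| N) => [/(homomorphic_small_graph F0 Gfree)[i]|NG].
  exact: homomorphic_union.
apply: (@homomorphic_union _ _ _ None); apply: NP => // v.
rewrite -(ler_nat R) !natrM natrD natrM.
have := le_trans degG (_ : _ <= (degree v)%:R); rewrite ler_nat min_degree_le => /(_ isT) dv.
rewrite -/h; apply: le_trans (_ : q%:R * h%:R * (gamma * #|G|%:R) <= _); last first.
  by rewrite ler_wpM2l // mulr_ge0.
rewrite mulrA ler_wpM2r //; move: q_e; rewrite /e; lra.
Qed.

(** * The lower bound s / (1 + s + t) *)

Local Open Scope nat_scope.

Lemma card_ord_lt n k : k <= n -> #|[set p : 'I_n | p < k]| = k.
Proof.
move=> kn; have w_inj : injective (widen_ord kn) by move=> x y /(congr1 val) xy; apply: val_inj.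
rewrite -[RHS](card_ord k) -(card_imset _ w_inj).
apply: eq_card => p; rewrite inE; apply/idP/imsetP => [pk|[j _ ->]] /=; last exact: ltn_ord.
by exists (Ordinal pk) => //; apply: val_inj.
Qed.

Lemma card_ord_shift n k (c : 'I_n.+1) : k <= n.+1 -> #|[set p | ((p + c)%R : 'I_n.+1) < k]| = k.
Proof.
move=> kn; rewrite -[RHS](card_ord_lt kn) -(card_imset [set p : 'I_n.+1 | p < k] (addIr (- c)%R)).
apply: eq_card => p; rewrite inE; apply/idP/imsetP => [pk|[j]].
  by exists (p + c)%R; rewrite ?inE // addrK.
by rewrite inE => jk ->; rewrite addrNK.
Qed.

Section CliqueGraph.
Variables s t m L : nat.
Local Notation M := m.+1.

(* The clique (g, l) of order s is joined, in the i-th copy of K_{1+t}, to the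
   vertices p of Z_{1+t} with p + g i in {0, .., s-1}. The proportions
   1 + t : s of the last two summands give degree s n / (1 + s + t) throughout,
   up to the bounded number of vertices in the copies of K_{1+t}. *)
Definition cg_vertex : finType :=
  ('I_M * 'I_t.+1 + {ffun 'I_M -> 'I_t.+1} * 'I_L * 'I_s + 'I_(s * (t.+1 ^ m * L * s)))%type.

Definition cg_adj : rel cg_vertex := fun u v =>
  match u, v with
  | inl (inl (i, p)), inl (inl (j, r)) => (i == j) && (p != r)
  | inl (inl (i, p)), inl (inr (g, _, _)) => ((p + g i)%R : 'I_t.+1) < s
  | inl (inr (g, _, _)), inl (inl (i, p)) => ((p + g i)%R : 'I_t.+1) < s
  | inl (inr (b, j)), inl (inr (b', j')) => (b == b') && (j != j')
  | inl (inr _), inr _ | inr _, inl (inr _) => true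
  | _, _ => false
  end.

Lemma cg_adj_sym : symmetric cg_adj.
Proof.
by move=> [[[i p]|[[g l] j]]|x] [[[i' p']|[[g' l'] j']]|x'] //=; rewrite eq_sym;
  congr (_ && ~~ _); apply: eq_sym.
Qed.

Lemma cg_adj_irr : irreflexive cg_adj.
Proof. by move=> [[[i p]|[[g l] j]]|x] //=; rewrite !eqxx. Qed.

Definition clique_graph : sgraph := SGraph cg_adj_sym cg_adj_irr.

Lemma card_clique_graph :
  #|clique_graph| = M * t.+1 + (1 + s + t) * (t.+1 ^ m * L * s).
Proof.
rewrite !card_sum !card_prod !card_ffun !card_ord expnS; lia.
Qed.

(** A vertex of a K_{1+t} sees a proportion s / (1 + t) of the vertices in copies of K_s; a vertex
    of a K_s sees the independent set, and an independent vertex sees all copies of K_s. *)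
Lemma clique_graph_degree (v : clique_graph) : s <= t -> s * (t.+1 ^ m * L * s) <= degree v.
Proof.
move=> st.
have imP (T : finType) (A : {set T}) (f : T -> clique_graph) : injective f ->
    {in A, forall x, cg_adj v (f x)} -> #|A| <= degree v.
  move=> f_inj fA; rewrite -(card_imset A f_inj); apply/subset_leq_card/subsetP=> w.
  by case/imsetP=> x xA ->; rewrite inE; apply: fA.
case: v imP => [[[i p]|[[g l] j]]|x] imP.
- pose B := setX (setX [set g : {ffun 'I_M -> 'I_t.+1} | ((p + g i)%R : 'I_t.+1) < s]
    [set: 'I_L]) [set: 'I_s].
  apply: leq_trans (imP _ B (fun y => inl (inr y)) _ _); last 2 first.
  + by move=> y y' [].
  + by move=> [[g l] j]; rewrite !inE /= !andbT.
  rewrite !cardsX !cardsT !card_ord.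
  (* Coordinate [i] of [g] has s admissible values, the m others are free. *)
  have -> : #|[set g : {ffun 'I_M -> 'I_t.+1} | ((p + g i)%R : 'I_t.+1) < s]| = s * t.+1 ^ m.
    pose Fm k := [pred c : 'I_t.+1 | (k == i) ==> (((p + c)%R : 'I_t.+1) < s)].
    transitivity #|(family Fm : {pred {ffun 'I_M -> 'I_t.+1}})|.
      apply: eq_card => g; rewrite inE; apply/idP/familyP => [gs k|/(_ i)]; rewrite inE /=.
        by apply/implyP => /eqP->.
      by rewrite eqxx.
    rewrite card_family foldrE big_map big_enum (bigD1 i) //=; congr (_ * _).
      rewrite -[RHS](card_ord_shift p (leqW st)); apply: eq_card => c.
      by rewrite [RHS]inE -topredE /= eqxx addnC.
    rewrite (eq_bigr (fun=> t.+1)) => [|k /negPf ki].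
      by rewrite prod_nat_const cardC1 card_ord.
    by rewrite -[RHS](card_ord t.+1); apply: eq_card => c; rewrite inE ki.
  by rewrite !mulnA.
- apply: leq_trans (imP _ [set: 'I__] (fun x => inr x) _ _); last 2 first.
  + by move=> y y' [].
  + by [].
  by rewrite cardsT card_ord.
- apply: leq_trans (imP _ [set: _] (fun y => inl (inr y)) _ _); last 2 first.
  + by move=> y y' [].
  + by [].
  rewrite cardsT !card_prod card_ffun !card_ord expnS -!(mulnA t.+1).
  by rewrite leq_mul2r (leqW st) orbT.
Qed.

Definition cg_clique (v : cg_vertex) : option 'I_M :=
  if v is inl (inl (i, _)) then Some i else None.

Definition cg_block (v : cg_vertex) : option ({ffun 'I_M -> 'I_t.+1} * 'I_L) :=
  if v is inl (inr (b, _)) then Some b else None.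

(** These are the neighbours in the i-th K_{1+t} of a K_s indexed by [g]; two such sets of positions
    can cover K_{1+t} when 1 + t <= 2s. *)
Definition cg_half i (g : {ffun 'I_M -> 'I_t.+1}) : {set cg_vertex} :=
  [set inl (inl (i, p)) | p in [set p | ((p + g i)%R : 'I_t.+1) < s]].

Lemma card_cg_clique i : #|[set v | cg_clique v == Some i]| <= t.+1.
Proof.
apply: leq_trans (_ : #|[set (inl (inl (i, p)) : cg_vertex) | p in 'I_t.+1]| <= _).
  apply/subset_leq_card/subsetP=> -[[[j p]|[b j]]|x]; rewrite inE //= => /eqP[->].
  exact: imset_f.
by apply: leq_trans (leq_imset_card _ _) _; rewrite card_ord.
Qed.

Lemma card_cg_block b : #|[set v | cg_block v == Some b]| <= s.
Proof.
apply: leq_trans (_ : #|[set (inl (inr (b, j)) : cg_vertex) | j in 'I_s]| <= _).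
  apply/subset_leq_card/subsetP=> -[[[j p]|[b' j]]|x]; rewrite inE //= => /eqP[->].
  exact: imset_f.
by apply: leq_trans (leq_imset_card _ _) _; rewrite card_ord.
Qed.

Lemma card_cg_half i g : s <= t -> #|cg_half i g| <= s.
Proof.
by move=> st; apply: leq_trans (leq_imset_card _ _) _; rewrite card_ord_shift // leqW.
Qed.

Lemma cg_adj_clique u v i i' :
  cg_adj u v -> cg_clique u = Some i -> cg_clique v = Some i' -> i' = i.
Proof.
case: u v => [[[j p]|[b j]]|x] [[[j' p']|[b' j']]|x'] //=.
by case/andP=> /eqP-> _ [->] [->].
Qed.

Lemma cg_adj_block u v b b' :
  cg_adj u v -> cg_block u = Some b -> cg_block v = Some b' -> b' = b.
Proof.
case: u v => [[[j p]|[[g l] j]]|x] [[[j' p']|[[g' l'] j']]|x'] //=.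
by case/andP=> /eqP-> _ [->] [->].
Qed.

Lemma cg_adj_half u v i g l :
  cg_adj u v -> cg_clique u = Some i -> cg_block v = Some (g, l) -> u \in cg_half i g.
Proof.
case: u v => [[[j p]|[b1 j]]|x] [[[j' p']|[b2 j']]|x'] //=.
case: b2 => g' l' pg [ji] [gg _]; subst g' j.
by apply/imsetP; exists p; rewrite ?inE.
Qed.

(** A copy avoids the independent set. Then it lies in one K_{1+t}, or in a half of it together with
    one K_s, at most 2s vertices, or its centre and one of the other two parts lie in a set of order
    s: all too small. *)
Lemma clique_graph_free : 0 < s -> s <= t -> Defs.free (complete_tripartite 1 s t) clique_graph.
Proof.
move=> s0 st [f f_inj fP].
have t0 : 0 < t by apply: leq_trans st.
pose c : complete_tripartite 1 s t := inl (inl ord0).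
pose S (i : 'I_s) : complete_tripartite 1 s t := inl (inr i).
pose T (j : 'I_t) : complete_tripartite 1 s t := inr j.
have HP (P : complete_tripartite 1 s t -> Prop) :
    P c -> (forall i, P (S i)) -> (forall j, P (T j)) -> forall z, P z.
  by move=> Pc PS PT [[i|i]|i]; [rewrite (ord1 i)|exact: PS|exact: PT].
have cardP (P : {set complete_tripartite 1 s t}) (Q : {set cg_vertex}) :
    {in P, forall z, f z \in Q} -> #|P| <= #|Q|.
  move=> PQ; rewrite -(card_imset P f_inj); apply/subset_leq_card/subsetP=> w.
  by case/imsetP=> z zP ->; apply: PQ.
have cardS (Q : {set cg_vertex}) : f c \in Q -> (forall i, f (S i) \in Q) -> 1 + s <= #|Q|.
  move=> cQ SQ; have /cardP : {in c |: [set S i | i in 'I_s], forall z, f z \in Q}.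
    by move=> z; rewrite in_setU1 => /predU1P[->|/imsetP[k _ ->]].
  have S_inj : injective S by move=> x y [].
  rewrite cardsU1 (card_imset _ S_inj) card_ord (_ : c \notin _) //.
  by apply/imsetP=> -[].
have cardT (Q : {set cg_vertex}) : f c \in Q -> (forall j, f (T j) \in Q) -> 1 + t <= #|Q|.
  move=> cQ TQ; have /cardP : {in c |: [set T i | i in 'I_t], forall z, f z \in Q}.
    by move=> z; rewrite in_setU1 => /predU1P[->|/imsetP[k _ ->]].
  have T_inj : injective T by move=> x y [].
  rewrite cardsU1 (card_imset _ T_inj) card_ord (_ : c \notin _) //.
  by apply/imsetP=> -[].
have cardH (Q : {set cg_vertex}) :
    f c \in Q -> (forall i, f (S i) \in Q) -> (forall j, f (T j) \in Q) -> 1 + s + t <= #|Q|.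
  move=> cQ SQ TQ; rewrite -(card_complete_tripartite 1 s t) -cardsT; apply: cardP => z _.
  by move: z; apply: HP.
have cS i : cg_adj (f c) (f (S i)) by apply: fP.
have Sc i : cg_adj (f (S i)) (f c) by apply: fP.
have cT j : cg_adj (f c) (f (T j)) by apply: fP.
have Tc j : cg_adj (f (T j)) (f c) by apply: fP.
have ST i j : cg_adj (f (S i)) (f (T j)) by apply: fP.
have TS i j : cg_adj (f (T j)) (f (S i)) by apply: fP.
(* In the copy every neighbourhood is connected and has more than s vertices; around an independent
   vertex it would have to lie in a single K_s. *)
have noX z : (exists i, cg_clique (f z) = Some i) \/ (exists b, cg_block (f z) = Some b).
  case clz: (cg_clique (f z)) => [i|]; first by left; exists i.
  case blz: (cg_block (f z)) => [b|]; first by right; exists b.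
  have nb w : cg_adj (f z) w -> exists b, cg_block w = Some b.
    case: (f z) w clz blz => [[[j p]|[b1 j]]|x] [[[j' p']|[b2 j']]|x'] //=.
    by exists b2.
  exfalso; move: z nb {clz blz}; apply: HP.
  - move=> nb; have [b Sb] := nb _ (cS (Ordinal s0)).
    have Tb j : f (T j) \in [set v | cg_block v == Some b].
      have [b' Tb] := nb _ (cT j); rewrite inE Tb.
      by rewrite (cg_adj_block (ST (Ordinal s0) j) Sb Tb).
    have Sb' i : f (S i) \in [set v | cg_block v == Some b].
      have [b' Sb'] := nb _ (cS i); have := Tb (Ordinal t0); rewrite !inE Sb' => /eqP Tb'.
      by rewrite (cg_adj_block (TS i (Ordinal t0)) Tb' Sb').
    have : #|[set S i | i in 'I_s] :|: [set T j | j in 'I_t]| <= s.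
      apply: leq_trans (card_cg_block b); apply: cardP => z.
      by rewrite in_setU => /orP[] /imsetP[k _ ->].
    have S_inj : injective S by move=> x y [].
    have T_inj : injective T by move=> x y [].
    rewrite cardsU (_ : _ :&: _ = set0).
      by rewrite !card_imset // !card_ord cards0 subn0 -[X in _ <= X]addn0 leq_add2l leqNgt t0.
    by apply/setP=> z; rewrite !inE; apply/andP=> -[/imsetP[k _ ->] /imsetP[]].
  - move=> i nb; have [b cb] := nb _ (Sc i).
    have := leq_trans (cardT _ _ _) (card_cg_block b).
    rewrite ltnNge st => /(_ _ _)/= F; apply: notF; apply: F; first by rewrite inE cb.
    move=> j; have [b' Tb] := nb _ (ST i j).
    by rewrite inE Tb (cg_adj_block (cT j) cb Tb).
  - move=> j nb; have [b cb] := nb _ (Tc j).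
    have := leq_trans (cardS _ _ _) (card_cg_block b).
    rewrite ltnn => F; apply: notF; apply: F; first by rewrite inE cb.
    move=> i; have [b' Sb] := nb _ (TS i j).
    by rewrite inE Sb (cg_adj_block (cS i) cb Sb).
case cc: (cg_clique (f c)) => [i0|].
  have dichS i : cg_clique (f (S i)) = Some i0 \/ exists b, cg_block (f (S i)) = Some b.
    by have [[k Sk]|] := noX (S i); [left; rewrite Sk (cg_adj_clique (cS i) cc Sk)|right].
  have dichT j : cg_clique (f (T j)) = Some i0 \/ exists b, cg_block (f (T j)) = Some b.
    by have [[k Tk]|] := noX (T j); [left; rewrite Tk (cg_adj_clique (cT j) cc Tk)|right].
  case: (pickP (fun i => cg_block (f (S i)) != None)) => [i|noS].
    case: (pickP (fun j => cg_block (f (T j)) != None)) => [j|noT].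
      case bT: (cg_block (f (T j))) => [b|//] _; case bS: (cg_block (f (S i))) => [[g l]|//] _.
      have eb := cg_adj_block (ST i j) bS bT; subst b.
      have := cardH (cg_half i0 g :|: [set v | cg_block v == Some (g, l)]).
      move=> F; suff : 1 + s + t <= s + s by lia.
      apply: leq_trans (F _ _ _) (leq_trans (leq_card_setU _ _) _).
      + by rewrite in_setU (cg_adj_half (cS i) cc bS).
      + move=> k; rewrite in_setU; have [Sk|[b Sk]] := dichS k.
          by rewrite (cg_adj_half (ST k j) Sk bT).
        by rewrite orbC inE Sk (cg_adj_block (TS k j) bT Sk) eqxx.
      + move=> k; rewrite in_setU; have [Tk|[b Tk]] := dichT k.
          by rewrite (cg_adj_half (TS i k) Tk bS).
        by rewrite orbC inE Tk (cg_adj_block (ST i k) bS Tk) eqxx.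
      + by apply: leq_add; [apply: card_cg_half|apply: card_cg_block].
    case bS: (cg_block (f (S i))) => [[g l]|//] _.
    suff : 1 + t <= s by lia.
    apply: leq_trans (cardT (cg_half i0 g) _ _) (card_cg_half _ _ st).
      exact: cg_adj_half (cS i) cc bS.
    move=> k; have [Tk|[b Tk]] := dichT k; last by have := noT k; rewrite Tk.
    exact: cg_adj_half (TS i k) Tk bS.
  have allS k : cg_clique (f (S k)) = Some i0.
    by have [//|[b Sk]] := dichS k; have := noS k; rewrite Sk.
  case: (pickP (fun j => cg_block (f (T j)) != None)) => [j|noT].
    case bT: (cg_block (f (T j))) => [[g l]|//] _.
    suff : 1 + s <= s by lia.
    apply: leq_trans (cardS (cg_half i0 g) _ _) (card_cg_half _ _ st).
      exact: cg_adj_half (cT j) cc bT.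
    by move=> k; exact: cg_adj_half (ST k j) (allS k) bT.
  suff : 1 + s + t <= t.+1 by lia.
  apply: leq_trans (cardH [set v | cg_clique v == Some i0] _ _ _) (card_cg_clique _).
  - by rewrite inE cc.
  - by move=> k; rewrite inE allS.
  - move=> k; rewrite inE; have [->//|[b Tk]] := dichT k.
    by have := noT k; rewrite Tk.
have [[i]|[[g l] bc]] := noX c; first by rewrite cc.
have dichS i : cg_block (f (S i)) = Some (g, l) \/ exists k, cg_clique (f (S i)) = Some k.
  by have [|[b Sb]] := noX (S i); [right|left; rewrite Sb (cg_adj_block (cS i) bc Sb)].
have dichT j : cg_block (f (T j)) = Some (g, l) \/ exists k, cg_clique (f (T j)) = Some k.
  by have [|[b Tb]] := noX (T j); [right|left; rewrite Tb (cg_adj_block (cT j) bc Tb)].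
case: (pickP (fun i => cg_clique (f (S i)) != None)) => [i|noS]; last first.
  suff : 1 + s <= s by lia.
  apply: leq_trans (cardS [set v | cg_block v == Some (g, l)] _ _) (card_cg_block _).
    by rewrite inE bc.
  move=> k; rewrite inE; have [->//|[b Sk]] := dichS k; by have := noS k; rewrite Sk.
case: (pickP (fun j => cg_clique (f (T j)) != None)) => [j|noT]; last first.
  suff : 1 + t <= s by lia.
  apply: leq_trans (cardT [set v | cg_block v == Some (g, l)] _ _) (card_cg_block _).
    by rewrite inE bc.
  move=> k; rewrite inE; have [->//|[b Tk]] := dichT k; by have := noT k; rewrite Tk.
case aT: (cg_clique (f (T j))) => [i0|//] _; case aS: (cg_clique (f (S i))) => [i1|//] _.
have ei := cg_adj_clique (ST i j) aS aT; subst i1.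
suff : 1 + s + t <= s + s by lia.
apply: leq_trans (cardH (cg_half i0 g :|: [set v | cg_block v == Some (g, l)]) _ _ _)
  (leq_trans (leq_card_setU _ _) _).
- by rewrite in_setU orbC inE bc eqxx.
- move=> k; rewrite in_setU; have [Sk|[i1 Sk]] := dichS k; first by rewrite orbC inE Sk eqxx.
  have ei := cg_adj_clique (TS k j) aT Sk; subst i1.
  by rewrite (cg_adj_half (Sc k) Sk bc).
- move=> k; rewrite in_setU; have [Tk|[i1 Tk]] := dichT k; first by rewrite orbC inE Tk eqxx.
  have ei := cg_adj_clique (ST i k) aS Tk; subst i1.
  by rewrite (cg_adj_half (Tc k) Tk bc).
- by apply: leq_add; [apply: card_cg_half|apply: card_cg_block].
Qed.

Lemma clique_graph_hom (F : sgraph) :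
  0 < s -> s <= t -> 0 < L -> t.+1 <= s + s -> #|F| ^ t.+1 < M ->
  homomorphic clique_graph F -> contains F (complete_tripartite 1 s t).
Proof.
move=> s0 st L0 ts FM [f fP].
pose row (i : 'I_M) : {ffun 'I_t.+1 -> F} := [ffun p => f (inl (inl (i, p)))].
have /injectivePn[i [j ij rij]] : ~~ injectiveb row.
  by apply/injectiveP=> /leq_card; rewrite card_ffun !card_ord leqNgt FM.
(* Shift 0 in copy [i] covers 0, .., s-1; shift t + 1 - s in copy [j] covers s, .., t, because there
   p - s < s. *)
pose g : {ffun 'I_M -> 'I_t.+1} := [ffun k => if k == j then inord (t.+1 - s) else 0%R].
pose y (k : 'I_s) : clique_graph := inl (inr ((g, Ordinal L0), k)).
pose a (p : 'I_t.+1) : clique_graph := inl (inl (i, p)).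
have ay p k : adj (f (a p)) (f (y k)).
  have [ps|sp] := ltnP p s; first by apply: fP; rewrite /= ffunE (negPf ij) addn0 modn_small.
  have -> : f (a p) = f (inl (inl (j, p))) by have /ffunP/(_ p) := rij; rewrite !ffunE.
  apply: fP; rewrite /= ffunE eqxx /= inordK; last by move: s0; clear; lia.
  have -> : p + (t.+1 - s) = p - s + t.+1 by move: sp st (ltn_ord p); clear; lia.
  rewrite modnDr modn_small; move: s0 sp st ts (ltn_ord p); clear; lia.
pose phi (x : complete_tripartite 1 s t) : F :=
  match x with
  | inl (inl _) => f (a ord0)
  | inl (inr k) => f (y k)
  | inr r => f (a (lift ord0 r))
  end.
have phiP x z : x != z -> adj (phi x) (phi z).
  have aa p r : p != r -> adj (f (a p)) (f (a r)) by move=> pr; apply: fP; rewrite /= eqxx.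
  have ya p k : adj (f (y k)) (f (a p)) by rewrite adj_sym.
  case: x z => [[x|x]|x] [[z|z]|z] xz; rewrite /phi //.
  - by move: xz; rewrite (ord1 x) (ord1 z) eqxx.
  - exact: aa.
  - by apply: fP; rewrite /= eqxx; apply: contra xz => /eqP->.
  - by apply: aa; rewrite eq_sym; apply: neq_lift.
  - by apply: aa; apply: contra xz => /eqP/lift_inj->.
exists phi => [x z xz|x z xz]; last first.
  by apply: phiP; apply: contraTneq xz => ->; rewrite adj_irr.
by apply/eqP; apply: contraT => /phiP; rewrite xz adj_irr.
Qed.

End CliqueGraph.

Local Open Scope ring_scope.

Lemma hom_bounding_tripartite (R : realType) s t (gamma : R) : (0 < s)%N -> (s <= t)%N ->
  (t.+1 <= s + s)%N -> hom_bounding R (complete_tripartite 1 s t) gamma ->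
  s%:R / (1 + s + t)%:R <= gamma.
Proof.
move=> s0 st ts [g0 [F Ffree Fhom]]; rewrite leNgt; apply/negP.
set h := (1 + s + t)%N; have h0 : 0 < h%:R :> R by rewrite ltr0n.
rewrite ltr_pdivlMr // => lt_g.
pose m := (#|F| ^ t.+1)%N.
(* [L] is chosen so that gamma times the number of vertices in the copies of K_{1+t} stays below the
   gain L e. *)
pose e := s%:R - gamma * h%:R.
have e0 : 0 < e by rewrite subr_gt0.
pose L := (Num.truncn (gamma * (m.+1 * t.+1)%:R / e)).+1.
have Le : gamma * (m.+1 * t.+1)%:R < L%:R * e.
  by rewrite -ltr_pdivrMr //; apply: truncnS_gt.
apply: Ffree; apply: (@clique_graph_hom s t m L) => //.
apply: Fhom; first exact: clique_graph_free.
set G := clique_graph s t m L; set N := (t.+1 ^ m * L * s)%N.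
have NL : (L <= N)%N by rewrite /N -mulnA mulnCA leq_pmulr // muln_gt0 expn_gt0.
have dN : (s * N <= min_degree G)%N.
  apply: le_min_degree => [|v]; last exact: clique_graph_degree.
  by rewrite card_clique_graph -/N (leq_trans _ (leq_addl _ _)) // leq_mul2r; lia.
apply: le_trans (_ : (s * N)%:R <= _); last by rewrite ler_nat.
rewrite card_clique_graph -/N -/h natrD !(natrM _ _ N) mulrDr.
have : L%:R * e <= N%:R * e by rewrite ler_wpM2r ?ler_nat // ltW.
rewrite /e in Le *; move: Le; lra.
Qed.

(** * The lower bound 1 / 3 *)

Local Open Scope nat_scope.

(** * Harris' and Chebyshev's inequalities on the cube *)

Lemma big_tuple_cons (R : Type) (idx : R) (op : Monoid.com_law idx) n (F : n.+1.-tuple bool -> R) :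
  \big[op/idx]_x F x =
  \big[op/idx]_(x : n.-tuple bool) op (F (cons_tuple true x)) (F (cons_tuple false x)).
Proof.
rewrite (reindex (fun p : bool * n.-tuple bool => cons_tuple p.1 p.2)) /=; last first.
  exists (fun x => (thead x, behead_tuple x)) => [[b x] _|x _] /=.
    by congr (_, _); apply: val_inj.
  by rewrite [RHS]tuple_eta; apply: val_inj.
rewrite -(pair_big xpredT xpredT (fun b x => F (cons_tuple b x))) /= big_bool -big_split.
by apply: eq_bigr.
Qed.

Lemma big_tuple0 (R : Type) (idx : R) (op : Monoid.law idx) (F : 0.-tuple bool -> R) :
  \big[op/idx]_x F x = F [tuple].
Proof. by apply: big_pred1 => x; apply/esym/eqP; apply: tuple0. Qed.

Definition tuple_le n (x y : n.-tuple bool) := [forall i, tnth x i ==> tnth y i].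

Definition down_closed n (P : pred (n.-tuple bool)) := forall x y, tuple_le x y -> P y -> P x.

Lemma tuple_le_cons n (b b' : bool) (x y : n.-tuple bool) :
  b <= b' -> tuple_le x y -> tuple_le (cons_tuple b x) (cons_tuple b' y).
Proof.
move=> bb /forallP xy; apply/forallP=> i; case: (unliftP ord0 i) => [j|] ->.
  by rewrite !tnthS.
by rewrite !tnth0; case: b b' bb => [] [].
Qed.

Lemma tuple_le_refl n (x : n.-tuple bool) : tuple_le x x.
Proof. by apply/forallP=> i; apply: implybb. Qed.

Lemma down_closed_cons n (P : pred (n.+1.-tuple bool)) b :
  down_closed P -> down_closed (fun x => P (cons_tuple b x)).
Proof. by move=> dP x y xy; apply/dP/tuple_le_cons. Qed.

(** Induction on the first coordinate: the halves satisfy p1 <= p0 and q1 <= q0, so (p0 + p1)(q0 +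
    q1) <= 2 (p0 q0 + p1 q1). *)
Lemma Harris n (P Q : pred (n.-tuple bool)) : down_closed P -> down_closed Q ->
  (\sum_x P x) * (\sum_x Q x) <= 2 ^ n * \sum_x (P x && Q x).
Proof.
elim: n P Q => [|n IH] P Q dP dQ.
  by rewrite !big_tuple0 expn0 mul1n; case: (P _); case: (Q _).
have mono (S : pred (n.+1.-tuple bool)) : down_closed S ->
    \sum_(x : n.-tuple bool) S (cons_tuple true x) <=
    \sum_(x : n.-tuple bool) S (cons_tuple false x).
  move=> dS; apply: leq_sum => x _; have := dS (cons_tuple false x) (cons_tuple true x).
  by rewrite tuple_le_cons ?tuple_le_refl //; case: (S _) => // ->.
rewrite !big_tuple_cons !big_split /= expnS.
have := IH _ _ (down_closed_cons (b := true) dP) (down_closed_cons (b := true) dQ).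
have := IH _ _ (down_closed_cons (b := false) dP) (down_closed_cons (b := false) dQ).
have := mono P dP; have := mono Q dQ.
set p1 := \sum_x _; set p0 := \sum_x _; set q1 := \sum_x _; set q0 := \sum_x _.
set r1 := \sum_x _; set r0 := \sum_x _; move: (2 ^ n) => N.
clear; nia.
Qed.

Lemma Harris_seq n (I : eqType) (r : seq I) (P : I -> pred (n.-tuple bool)) :
  {in r, forall i, down_closed (P i) /\ 2 ^ n <= 2 * \sum_x P i x} ->
  2 ^ n <= 2 ^ size r * \sum_(x : n.-tuple bool) all (fun i => P i x) r.
Proof.
elim: r => [|i r IH] Pr.
  by rewrite mul1n sum1_card card_tuple card_bool.
have [dPi sPi] := Pr i (mem_head _ _).
have Pr' : {in r, forall i, down_closed (P i) /\ 2 ^ n <= 2 * \sum_x P i x}.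
  by move=> j jr; apply: Pr; rewrite inE jr orbT.
have dr : down_closed (fun x => all (fun i => P i x) r).
  move=> x y xy /allP Py; apply/allP=> j jr; have [dPj _] := Pr' j jr.
  exact: dPj xy (Py j jr).
have := Harris dPi dr; have := IH Pr'; rewrite /= expnS.
have : 0 < 2 ^ n by rewrite expn_gt0.
move: sPi; move: (2 ^ size r) (2 ^ n) (\sum_x P i x) (\sum_x _) (\sum_x _) => a N p u v.
clear; nia.
Qed.

Local Open Scope ring_scope.

(** This is the second moment of a sum of independent signs; the shift [z] carries the induction. *)
Lemma sum_signs_sqr n (z : int) :
  \sum_(x : n.-tuple bool) (z + \sum_i (-1) ^+ tnth x i) ^+ 2 = (2 ^ n)%:R * (z ^+ 2 + n%:R).
Proof.
elim: n z => [|n IH] z; first by rewrite big_tuple0 big_ord0 expn0 mul1r !addr0.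
have IH2 b : \sum_(x : n.-tuple bool) (z + \sum_i (-1) ^+ tnth (cons_tuple b x) i) ^+ 2 =
    (2 ^ n)%:R * ((z + (-1) ^+ b) ^+ 2 + n%:R).
  rewrite -IH; apply: eq_bigr => x _; rewrite big_ord_recl tnth0 addrA; congr ((_ + _) ^+ 2).
  by apply: eq_bigr => i _; rewrite tnthS.
rewrite big_tuple_cons big_split !IH2 expnS natrM -natr1 /= expr0 expr1; ring.
Qed.

(** Chebyshev's inequality: the sum of signs is n minus twice the weight, which exceeds [r] on light
    tuples. *)
Lemma few_light n m r : (m + r <= n - m)%N ->
  (r ^ 2 * \sum_(x : n.-tuple bool) (\sum_i tnth x i < m) <= n * 2 ^ n)%N.
Proof.
move=> mr; rewrite -(ler_nat int) !natrM [leRHS]mulrC.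
have := @sum_signs_sqr n 0; rewrite expr0n add0r => <-.
rewrite natr_sum mulr_sumr; apply: ler_sum => x _; rewrite add0r.
case: ltnP => [lt_m|_]; last by rewrite mulr0 sqr_ge0.
have -> : \sum_i (-1) ^+ tnth x i = n%:R - (2 * \sum_i tnth x i)%:R :> int.
  rewrite natrM natr_sum mulr_sumr -[n in n%:R](card_ord n) -sumr_const -sumrB;
    apply: eq_bigr => i _.
  by case: (tnth x i).
rewrite mulr1 -expr2 lerXn2r ?nnegrE //; move: lt_m mr; move: (\sum_i _)%N; clear; lia.
Qed.

Local Open Scope nat_scope.

(** * Hajnal's graphs *)

Section HajnalGraph.
Variables n m l : nat.

Definition weight (x : n.-tuple bool) := \sum_i tnth x i.

(** Tuples are subsets of n points. Each point has 2l copies on one side of the complete bipartite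
    graph, and the other side has nl vertices: a tuple of weight near n/2 sees about nl of these 3nl
    vertices. *)
Definition hg_vertex : finType := (n.-tuple bool + 'I_n * 'I_l * bool + 'I_n * 'I_l)%type.

(* Light tuples carry no Kneser edge; joining them to all points keeps their
   degree large, so that no subtype of heavy tuples is needed. *)
Definition hg_adj : rel hg_vertex := fun u v =>
  match u, v with
  | inl (inl x), inl (inl y) =>
      [&& m <= weight x, m <= weight y & [forall i, ~~ (tnth x i && tnth y i)]]
  | inl (inl x), inl (inr (i, _, _)) | inl (inr (i, _, _)), inl (inl x) =>
      tnth x i || (weight x < m)
  | inl (inr _), inr _ | inr _, inl (inr _) => true
  | _, _ => false
  end.

Lemma hg_adj_sym : symmetric hg_adj.
Proof.
move=> [[x|[[i j] b]]|c] [[y|[[i' j'] b']]|c'] //=.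
rewrite andbCA; congr [&& _, _ & _]; apply: eq_forallb => i; by rewrite andbC.
Qed.

Hypothesis m0 : 0 < m.

Lemma hg_adj_irr : irreflexive hg_adj.
Proof.
move=> [[x|[[i j] b]]|c] //=; apply/negP=> /and3P[mx _ /forallP xx].
move: mx; rewrite leqNgt /weight big1 ?m0 // => i _.
by have := xx i; rewrite andbb; case: (tnth x i).
Qed.

Definition hajnal_graph : sgraph := SGraph hg_adj_sym hg_adj_irr.

Lemma card_hajnal_graph : #|hajnal_graph| = 2 ^ n + 3 * (n * l).
Proof.
rewrite !card_sum !card_prod card_tuple card_bool !card_ord; lia.
Qed.

Lemma hajnal_graph_degree (v : hajnal_graph) :
  2 * m <= n -> 2 * (m * l) <= degree v.
Proof.
move=> mn; have mnl : 2 * (m * l) <= n * l by rewrite mulnA leq_mul2r mn orbT.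
have imP (T : finType) (A : {set T}) (f : T -> hajnal_graph) : injective f ->
    {in A, forall x, hg_adj v (f x)} -> #|A| <= degree v.
  move=> f_inj fA; rewrite -(card_imset A f_inj); apply/subset_leq_card/subsetP=> w.
  by case/imsetP=> x xA ->; rewrite inE; apply: fA.
case: v imP => [[x|[[i j] b]]|c] imP.
- pose B := setX (setX [set i | tnth x i || (weight x < m)] [set: 'I_l]) [set: bool].
  apply: leq_trans (imP _ B (fun y => inl (inr y)) _ _); last 2 first.
  + by move=> y y' [].
  + by move=> [[i j] b]; rewrite !inE /= !andbT.
  rewrite !cardsX !cardsT card_ord card_bool mulnC leq_mul2r /= leq_mul2r; apply/orP; right.
  have [mx|xm] := leqP m (weight x).
    apply: leq_trans mx _; rewrite /weight -sum1_card [X in _ <= X]big_mkcond;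
      apply: leq_sum => i _.
    by rewrite inE orbF; case: (tnth x i).
  apply: leq_trans (_ : #|'I_n| <= _); first by rewrite card_ord; lia.
  by apply/subset_leq_card/subsetP=> i _; rewrite inE orbT.
- apply: leq_trans (imP _ [set: 'I_n * 'I_l] (fun x => inr x) _ _) => //.
  + by rewrite cardsT card_prod !card_ord.
  + by move=> y y' [].
- apply: leq_trans (imP _ [set: 'I_n * 'I_l * bool] (fun y => inl (inr y)) _ _) => //.
  + by rewrite cardsT !card_prod card_bool !card_ord; lia.
  + by move=> y y' [].
Qed.

(** There is no triangle: three disjoint subsets of order at least [m] would exceed n points, and
    adjacent tuples are heavy and disjoint, hence share no point. *)
Lemma hajnal_graph_free s t : 0 < s -> 0 < t -> n < 3 * m ->
  Defs.free (complete_tripartite 1 s t) hajnal_graph.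
Proof.
move=> s0 t0 nm [f _ fP].
pose c : complete_tripartite 1 s t := inl (inl ord0).
pose S : complete_tripartite 1 s t := inl (inr (Ordinal s0)).
pose T : complete_tripartite 1 s t := inr (Ordinal t0).
have tri u v w : hg_adj u v -> hg_adj v w -> hg_adj w u -> False.
  have AAB x y i : [&& m <= weight x, m <= weight y & [forall i, ~~ (tnth x i && tnth y i)]] ->
      tnth x i || (weight x < m) -> tnth y i || (weight y < m) -> False.
    by case/and3P=> mx my /forallP/(_ i) xy; rewrite !ltnNge mx my !orbF => xi yi;
      rewrite xi yi in xy.
  case: u v w => [[x|[[i j] b]]|a] [[y|[[i' j'] b']]|a'] [[z|[[i2 j2] b2]]|a2] //=.
  - case/and3P=> mx my /forallP xy /and3P[_ mz /forallP yz] /and3P[_ _ /forallP zx].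
    suff : weight x + weight y + weight z <= n by lia.
    rewrite /weight -!big_split /= -[X in _ <= X]card_ord -sum1_card; apply: leq_sum => i _.
    by have := xy i; have := yz i; have := zx i; do 3!case: (tnth _ i).
  - by move=> xy yi xi; apply: AAB xy xi yi.
  - by move=> xi zi zx; apply: AAB zx zi xi.
  - by move=> yi yz zi; apply: AAB yz yi zi.
exact: (tri (f c) (f S) (f T)) (fP _ _ _) (fP _ _ _) (fP _ _ _).
Qed.

Lemma hajnal_graph_hom (F : sgraph) r : m + r <= n - m -> n * 2 ^ #|F| < r ^ 2 ->
  ~ homomorphic hajnal_graph F.
Proof.
move=> mr nr [f fP].
pose up c (x : n.-tuple bool) :=
  [exists y : n.-tuple bool, [&& m <= weight y, f (inl (inl y)) == c & tuple_le y x]].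
pose P c := predC (up c).
have dP c : down_closed (P c).
  move=> x y xy; apply: contra => /existsP[z /and3P[mz fz zx]]; apply/existsP; exists z.
  rewrite mz fz; apply/forallP=> i; apply/implyP=> zi.
  by have /forallP/(_ i)/implyP := xy; apply; have /forallP/(_ i)/implyP := zx; apply.
pose co (x : n.-tuple bool) := map_tuple negb x.
have co_inv : involutive co by move=> x; apply: eq_from_tnth => i; rewrite !tnth_map negbK.
(* A colour class is intersecting, since adjacent tuples have distinct images. So the up-set [up c]
   it generates never contains both a tuple and its complement, and [P c] has density at least
   1/2. *)
have Pco c x : P c x || P c (co x).
  rewrite /P /= -negb_and; apply/negP=> /andP[/existsP[y /and3P[my /eqP fy yx]]].
  case/existsP=> z /and3P[mz /eqP fz zx].
  have : adj (f (inl (inl y))) (f (inl (inl z))).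
    apply: fP; rewrite /= my mz; apply/forallP=> i; apply/negP=> /andP[yi zi].
    have /forallP/(_ i) := zx; have /forallP/(_ i) := yx.
    by rewrite yi zi tnth_map /= => ->.
  by rewrite fy fz adj_irr.
have half c : 2 ^ n <= 2 * \sum_x P c x.
  rewrite mul2n -addnn [X in _ <= _ + X](reindex_inj (inv_inj co_inv)) -big_split /=.
  rewrite -[X in X ^ n]card_bool -card_tuple -sum1_card; apply: leq_sum => x _.
  by have := Pco c x; rewrite /P /=; case: (up c x); case: (up c (co x)).
have := @Harris_seq n F (enum F) P (fun c _ => conj (dP c) (half c)).
rewrite -cardE => H.
(* A heavy tuple lies in [up] of its own colour, so only light tuples satisfy every [P c]. *)
have light : \sum_(x : n.-tuple bool) all (fun c => P c x) (enum F) <=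
    \sum_(x : n.-tuple bool) (weight x < m).
  apply: leq_sum => x _; case: allP => // allx; rewrite ltnNge.
  have /negP nx := allx (f (inl (inl x))) (mem_enum _ _).
  case: (leqP m (weight x)) => // mx; case: nx; apply/existsP; exists x.
  by rewrite mx eqxx tuple_le_refl.
have := few_light mr; have n2 : 0 < 2 ^ n by rewrite expn_gt0.
move: H light; rewrite /weight; move: (\sum_x _) (\sum_x _) => u w H uw wP.
have : r ^ 2 * 2 ^ n <= n * 2 ^ #|F| * 2 ^ n.
  apply: leq_trans (leq_mul (leqnn _) H) _; rewrite mulnCA (mulnC n) -mulnA leq_mul2l.
  by rewrite (leq_trans _ wP) ?orbT // leq_mul2l uw orbT.
by rewrite leq_pmul2r // leqNgt nr.
Qed.

End HajnalGraph.

Local Open Scope ring_scope.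

Lemma hom_bounding_third (R : realType) s t (gamma : R) : (0 < s)%N -> (0 < t)%N ->
  hom_bounding R (complete_tripartite 1 s t) gamma -> 1 / 3 <= gamma.
Proof.
move=> s0 t0 [g0 [F Ffree Fhom]]; rewrite leNgt; apply/negP=> lt_g.
pose e := 1 - 3 * gamma; have e0 : 0 < e by rewrite /e; lra.
pose q := (Num.truncn e^-1).+2.
have q_e : 1 < q%:R * e.
  by rewrite -ltr_pdivrMr // div1r (lt_trans (truncnS_gt _)) // ltr_nat.
(* By Chebyshev's inequality fewer than 2^(n - #|F|) tuples are light; l = 2^n
   makes the Kneser part negligible. *)
pose r := (2 ^ #|F| * (2 * q + 1))%N.
have r0 : (0 < r)%N by rewrite muln_gt0 expn_gt0 addn1.
(* Here n = 2r (2q + 1), so n 2^|F| = 2 r^2 < (2r)^2, and m / n = q / (2q + 1) is close to 1/2. *)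
pose m := (2 * q * r)%N; pose n := (2 * m + 2 * r)%N; pose l := (2 ^ n)%N.
have m0 : (0 < m)%N by rewrite muln_gt0 r0.
have q2 : (1 < q)%N by [].
apply: (@hajnal_graph_hom n m l m0 F (2 * r)).
- by rewrite /n; lia.
- have -> : (n * 2 ^ #|F| = 2 * (r * r))%N by rewrite /n /m {3}/r; clear; lia.
  by move: r0; rewrite -mulnn; clear; nia.
apply: Fhom; first by apply: hajnal_graph_free => //; rewrite /n /m; nia.
have deg : (2 * (m * l) <= min_degree (hajnal_graph n l m0))%N.
  apply: le_min_degree => [|v].
    by rewrite card_hajnal_graph /n; nia.
  by apply: hajnal_graph_degree; rewrite /n leq_addr.
apply: le_trans (_ : (2 * (m * l))%:R <= _); last by rewrite ler_nat.
have r1 : 1 <= r%:R :> R by rewrite ler1n.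
have -> : #|hajnal_graph n l m0|%:R = l%:R * (1 + 3 * n%:R) :> R.
  by rewrite card_hajnal_graph -/l natrD !natrM; ring.
have -> : (2 * (m * l) = l * (2 * m))%N by rewrite [LHS]mulnA [LHS]mulnC.
rewrite mulrCA natrM ler_wpM2l ?ler0n //.
have mE (a b : nat) : (2 * (2 * a * b))%:R = 2 * (2 * a%:R * b%:R) :> R by rewrite !natrM.
have nE (a b : nat) : (2 * (2 * a * b) + 2 * b)%:R = 2 * (2 * a%:R * b%:R) + 2 * b%:R :> R.
  by rewrite natrD mE natrM.
rewrite /n /m nE mE.
have qr : r%:R <= r%:R * (q%:R * e) by rewrite ler_peMr ?ler0n // ltW.
have re : 0 <= r%:R * e by rewrite mulr_ge0 // ltW.
have -> : gamma = (1 - e) / 3 by rewrite /e; lra.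
by move: e0 r1 qr re; move: (e) (q%:R : R) (r%:R : R); clear; move=> x y z; lra.
Qed.

(** Degrees are below the order, so at ratio 1 only the graph without vertices remains. The
    threshold is thus the infimum of a nonempty set. *)
Lemma hom_bounding1 (R : realType) (H : sgraph) (c : H) : hom_bounding R H 1.
Proof.
have void_irr : irreflexive (fun _ _ : void => false) by [].
have void_sym : symmetric (fun _ _ : void => false) by [].
split=> //; exists (SGraph void_sym void_irr) => [[f _ _]|G _ dG]; first by case: (f c).
suff G0 (x : G) : False by exists (fun x => False_rect _ (G0 x)) => x; case: (G0 x).
have : (degree x < #|G|)%N.
  rewrite -cardsT; apply: proper_card; apply/properP; split; first exact: subsetT.
  by exists x; rewrite ?inE ?adj_irr.
rewrite ltnNge (leq_trans _ (min_degree_le x)) //.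
by rewrite -(ler_nat R) -[leLHS]mul1r.
Qed.

Theorem theorem1p1 (R : realType) (s t : nat) (hs : (1 <= s)%N) (hst : (s <= t)%N) :
  Num.max (1 / 3) (s%:R / (1 + s + t)%:R)
    <= hom_threshold R (complete_tripartite 1 s t)
  /\ (((t - s + 1) ^ 2 <= s)%N -> (2 + 2 * t <= 3 * s)%N ->
      hom_threshold R (complete_tripartite 1 s t) = s%:R / (1 + s + t)%:R).
Proof.
have t0 : (0 < t)%N by apply: leq_trans hst.
have h0 : 0 < (1 + s + t)%:R :> R by rewrite ltr0n.
have third gamma : hom_bounding R (complete_tripartite 1 s t) gamma -> 1 / 3 <= gamma.
  exact: hom_bounding_third.
have lower : Num.max (1 / 3) (s%:R / (1 + s + t)%:R) <= hom_threshold R (complete_tripartite 1 s t).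
  apply: lb_le_inf => [|gamma gP].
    by exists 1; apply: (@hom_bounding1 _ (complete_tripartite 1 s t) (inl (inl ord0))).
  (* If t >= 2s, then s / (1 + s + t) is below 1/3 and the first bound suffices. *)
  rewrite ge_max third //=; have [ts|ts] := leqP t.+1 (s + s).
    exact: hom_bounding_tripartite.
  apply: le_trans (third _ gP); rewrite ler_pdivrMr // mulrAC ler_pdivlMr //.
  by rewrite mul1r -natrM ler_nat; lia.
split=> // hd h2; apply/le_anti/andP; split; last first.
  by apply: le_trans lower; rewrite le_max lexx orbT.
apply/ler_addgt0Pr => e e0; apply: ge_inf; first by exists 0 => gamma [].
by apply: hom_bounding_above => //; rewrite ltrDl.
Qed.
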